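(* Let $\Delta$ be a shellable simplicial complex with vertex set $\{x_1,\dots,x_n\}$, let $s_1,\dots,s_n$ be positive integers, let $K$ be a field, and let $R=K[x_1,\dots,x_n]$ and $R'=K[x_{11},\dots,x_{1s_1},\dots,x_{n1},\dots,x_{ns_n}]$ be polynomial rings over $K$. Then $$\mathrm{pd}(R'/I_{\Delta^{(s_1,\dots,s_n)}})=\mathrm{pd}(R/I_\Delta)+s_1+\cdots+s_n-n$$ and $$\mathrm{depth}(R'/I_{\Delta^{(s_1,\dots,s_n)}})=\mathrm{depth}(R/I_\Delta).$$
   Context: Simplicial complexes are finite; $\mathcal{F}(\Delta)$ denotes the set of facets (maximal faces) of $\Delta$, and $[s]=\{1,\dots,s\}$. $I_\Delta$ denotes the Stanley-Reisner ideal of $\Delta$ (generated by the squarefree monomials of non-faces) in the polynomial ring over $K$ on the vertices of $\Delta$. Expansion: for a simplicial complex $\Delta$ with vertex set $\{x_1,\dots,x_n\}$ and positive integers $s_1,\dots,s_n$, the $(s_1,\dots,s_n)$-expansion $\Delta^{(s_1,\dots,s_n)}$ is the simplicial complex with vertex set $\{x_{11},\dots,x_{1s_1},x_{21},\dots,x_{2s_2},\dots,x_{n1},\dots,x_{ns_n}\}$ whose facets are exactly the sets $\{x_{i_1r_1},\dots,x_{i_kr_k}\}$ where $\{x_{i_1},\dots,x_{i_k}\}\in\mathcal{F}(\Delta)$ with $i_1<\cdots<i_k$ and $(r_1,\dots,r_k)\in[s_{i_1}]\times\cdots\times[s_{i_k}]$. Shellable (in the non-pure sense): $\Delta$ is shellable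 if there exists an ordering $F_1<\cdots<F_m$ of all the facets of $\Delta$ such that for any $i<j$ there exist a vertex $v\in F_j\setminus F_i$ and an index $\ell<j$ with $F_j\setminus F_\ell=\{v\}$. The projective dimension is $\mathrm{pd}(M)=\max\{i: \beta_{i,j}(M)\neq0\text{ for some }j\}$, where $\beta_{i,j}(M)$ are the graded Betti numbers of the graded module $M$ over the respective polynomial ring ($R$ or $R'$, standard grading); depth is with respect to the homogeneous maximal ideal. *)

(* Defs.v *)
From Stdlib Require Import ClassicalEpsilon.
From mathcomp Require Import all_boot all_order all_algebra.
From mathcomp Require Import mpoly.

Set Implicit Arguments.
Unset Strict Implicit.
Unset Printing Implicit Defensive.

Import GRing.Theory.
Local Open Scope ring_scope.

Definition simplicial_complex (T : finType) (D : {set {set T}}) : Prop :=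
  [/\ set0 \in D,
      forall x : T, [set x] \in D &
      forall A B : {set T}, A \in D -> B \subset A -> B \in D].

Definition facets (T : finType) (D : {set {set T}}) : {set {set T}} :=
  [set F : {set T} | maxset (fun A => A \in D) F].

(* Nonpure shellability; [s] is the shelling order, listed from 0. *)
Definition shellable (T : finType) (D : {set {set T}}) : Prop :=
  exists s : seq {set T},
    [/\ uniq s, s =i facets D &
      forall i j : nat, (i < j)%N -> (j < size s)%N ->
        exists v : T,
          v \in nth set0 s j :\: nth set0 s i /\
          (exists l : nat, (l < j)%N /\
             nth set0 s j :\: nth set0 s l = [set v])].

(* The vertex x_{i,r} of the expansion is [tagnat.Rank i r], i.e. the ordinal
   s_0 + ... + s_(i-1) + r. A choice of copies is a function r on all of 'I_n,
   of which only the restriction to F matters; this is harmless when every s_i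
   is positive. That the sets below are exactly the facets of the complex they
   generate is [mem_facets_expansion]. *)
Definition expansion_facet (n : nat) (s : 'I_n -> nat) (F : {set 'I_n})
    (r : {dffun forall i : 'I_n, 'I_(s i)}) : {set 'I_(\sum_(i < n) s i)} :=
  [set tagnat.Rank i (r i) | i in F].

Definition expansion (n : nat) (s : 'I_n -> nat) (D : {set {set 'I_n}}) :
    {set {set 'I_(\sum_(i < n) s i)}} :=
  [set A : {set _} | [exists F in facets D,
     [exists r : {dffun forall i : 'I_n, 'I_(s i)},
        A \subset expansion_facet F r]]].

Definition stanley_reisner (K : fieldType) (n : nat) (D : {set {set 'I_n}})
    (f : {mpoly K[n]}) : Prop :=
  exists c : {set 'I_n} -> {mpoly K[n]},
    f = \sum_(A : {set 'I_n} | A \notin D) c A * \prod_(i in A) 'X_i.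

Definition irrelevant (K : fieldType) (n : nat) (f : {mpoly K[n]}) : Prop :=
  f@_0%MM = 0.

Definition ideal_add (K : fieldType) (n : nat) (I : {mpoly K[n]} -> Prop)
    (fs : seq {mpoly K[n]}) (g : {mpoly K[n]}) : Prop :=
  exists c : 'I_(size fs) -> {mpoly K[n]},
    I (g - \sum_(i < size fs) c i * fs`_i).

(* Arbitrary when P is empty or unbounded. *)
Definition nat_max (P : nat -> Prop) : nat :=
  epsilon (inhabits 0%N) (fun m => P m /\ (forall k, P k -> (k <= m)%N)).

(* A minimal graded free resolution
     ... -> F_2 -> F_1 -> F_0 -> K[x]/I -> 0,
   where F_i = \bigoplus_k K[x](- mgr_deg i k) is the space of row vectors of
   length [mgr_rank i], the differential F_(i+1) -> F_i is v |-> v *m mgr_map i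
   and the augmentation F_0 -> K[x]/I is induced by v |-> v *m mgr_aug.
   Degree shifts can be taken in nat because K[x]/I lives in degrees >= 0. *)
Record min_graded_resolution (K : fieldType) (n : nat)
    (I : {mpoly K[n]} -> Prop) := MinGradedResolution {
  mgr_rank : nat -> nat;
  mgr_deg : forall i : nat, 'I_(mgr_rank i) -> nat;
  mgr_map : forall i : nat,
    'M[{mpoly K[n]}]_(mgr_rank i.+1, mgr_rank i);
  mgr_aug : 'cV[{mpoly K[n]}]_(mgr_rank 0);
  mgr_aug_homog : forall k, mgr_aug k 0 \is (mgr_deg k).-homog;
  (* The (k, l) entry is homogeneous of degree deg k - deg l in Z, and hence
     zero if this is negative. *)
  mgr_map_homog : forall i k l (m : 'X_{1.. n}),
    m \in msupp (mgr_map i k l) -> (mdeg m + mgr_deg l = mgr_deg k)%N;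
  mgr_aug_surj : forall f : {mpoly K[n]},
    exists v : 'rV[{mpoly K[n]}]_(mgr_rank 0), I (f - (v *m mgr_aug) 0 0);
  mgr_aug_exact : forall v : 'rV[{mpoly K[n]}]_(mgr_rank 0),
    I ((v *m mgr_aug) 0 0) <-> exists w, v = w *m mgr_map 0;
  mgr_map_exact : forall i (v : 'rV[{mpoly K[n]}]_(mgr_rank i.+1)),
    v *m mgr_map i = 0 <-> exists w, v = w *m mgr_map i.+1;
  mgr_minimal : forall i k l, irrelevant (mgr_map i k l)
}.

(* The graded Betti number beta_(i,j) of the module K[x]/I: the
   rank of the summand K[x](-j) of F_i, which does not depend on the choice of
   the minimal resolution. *)
Definition betti (K : fieldType) (n : nat) (I : {mpoly K[n]} -> Prop)
    (i j : nat) : nat :=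
  epsilon (inhabits 0%N) (fun b =>
    exists F : min_graded_resolution I,
      b = #|[set k : 'I_(mgr_rank F i) | mgr_deg k == j]|).

(* Projective dimension of the module K[x]/I, not of the ideal I. *)
Definition pd (K : fieldType) (n : nat) (I : {mpoly K[n]} -> Prop) : nat :=
  nat_max (fun i => exists j, betti I i j <> 0%N).

(* Regular sequences on the module K[x]/I; [ideal_add I (take i fs)] is the
   ideal I + (fs_0, ..., fs_(i-1)). *)
Definition regular_seq (K : fieldType) (n : nat) (I : {mpoly K[n]} -> Prop)
    (fs : seq {mpoly K[n]}) : Prop :=
  (forall i : nat, (i < size fs)%N -> forall g : {mpoly K[n]},
     ideal_add I (take i fs) (fs`_i * g) -> ideal_add I (take i fs) g) /\
  ~ ideal_add I fs 1.

(* Depth of the module K[x]/I with respect to (x_1, ..., x_n). *)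
Definition depth (K : fieldType) (n : nat) (I : {mpoly K[n]} -> Prop) : nat :=
  nat_max (fun d => exists fs : seq {mpoly K[n]},
    [/\ size fs = d, forall f, f \in fs -> irrelevant f & regular_seq I fs]).

Lemma mem_expansion_facet (n : nat) (s : 'I_n -> nat) (F : {set 'I_n})
    (r : {dffun forall i : 'I_n, 'I_(s i)}) (i : 'I_n) (k : 'I_(s i)) :
  (tagnat.Rank i k \in expansion_facet F r) = (i \in F) && (k == r i).
Proof.
apply/imsetP/andP => [[j jF e]|[iF /eqP->]]; last by exists i.
have ij : i = j.
  by rewrite -[i](tagnat.Rank1K (p_ := s) k) e tagnat.Rank1K.
split; first by rewrite ij.
case: j / ij {jF} e => /(congr1 val)/= /eqP.
by rewrite tagnat.eq_Rank eqxx => /eqP/val_inj->.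
Qed.

Lemma mem_facets_expansion (n : nat) (s : 'I_n -> nat) (D : {set {set 'I_n}})
    (A : {set 'I_(\sum_(i < n) s i)}) :
  A \in facets (expansion s D) <->
  exists F r, F \in facets D /\ A = expansion_facet F r.
Proof.
have inE' F r : F \in facets D -> expansion_facet F r \in expansion s D.
  move=> FD; rewrite inE; apply/existsP; exists F; rewrite FD.
  by apply/existsP; exists r.
split.
  rewrite inE => /maxsetP[]; rewrite inE => /existsP[F /andP[FD /existsP[r sAr]]].
  by move=> /(_ _ (inE' F r FD) sAr) <-; exists F, r.
case=> F [r [FD ->]]; rewrite inE; apply/maxsetP; split; first exact: inE'.
move=> B; rewrite inE => /existsP[G /andP[GD /existsP[q sBq]]] sFB.
have sub i : i \in F -> (i \in G) && (r i == q i).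
  move=> iF; rewrite -mem_expansion_facet (subsetP sBq)// (subsetP sFB)//.
  by rewrite mem_expansion_facet iF eqxx.
have GF : G = F.
  move: FD; rewrite inE => /maxsetP[_]; apply.
    by move: GD; rewrite inE => /maxsetP[].
  by apply/subsetP => i /sub/andP[].
apply/eqP; rewrite eqEsubset sFB andbT; apply: subset_trans sBq _.
apply/subsetP => _ /imsetP[i iG ->]; rewrite mem_expansion_facet.
by move: iG; rewrite GF => iF; rewrite iF /=; have /andP[_ /eqP->] := sub i iF.
Qed.

(* Main.v *)
(* Let d be the smallest size of a facet of a shellable complex D on n vertices.
   Then pd (R/I_D) = n - d and depth (R/I_D) = d; as an expansion of D is again
   shellable with facets of the same sizes, this gives both formulas.

   A shelling filters R/I_D with quotients isomorphic to shifts of the R/P_F, F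
   a facet, and the first d elementary symmetric polynomials form a regular
   sequence on each R/P_F, hence on R/I_D. On the other hand, if a minimal free
   resolution of R/I has a nonzero term in degree i and there is a regular
   sequence of length r on R/I, then i + r <= n: iterated mapping cones reduce
   this to r = 0, where one kills the variables one at a time. Finally, if F is
   a facet of size d, then P_F = I_D : x_F, and killing the n - d variables
   outside F turns x_F into a nonzero class in degree n - d of the resolution. *)
Require Import Defs.
From Stdlib Require Import ClassicalEpsilon FunctionalExtensionality PropExtensionality.
From mathcomp Require Import all_boot all_order all_algebra.
From mathcomp Require Import ring.
From mathcomp Require Import mpoly.

Set Implicit Arguments.
Unset Strict Implicit.
Unset Printing Implicit Defensive.

(** * Regular sequences modulo an ideal *)

Section Ideals.
Import GRing.Theory.
Local Open Scope ring_scope.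
Variables (K : fieldType) (n : nat).
Implicit Types (I J P : {mpoly K[n]} -> Prop) (f g u : {mpoly K[n]})
  (fs : seq {mpoly K[n]}).

Definition is_ideal I : Prop :=
  [/\ I 0, forall f g, I f -> I g -> I (f + g) & forall c f, I f -> I (c * f)].

Definition homog_ideal I : Prop :=
  is_ideal I /\ forall d f, I f -> I (pihomog mdeg d f).

Definition adj I u f : Prop := exists c, I (f - c * u).

Definition regular_mod I u : Prop := forall g, I (u * g) -> I g.

(** Recursion on the sequence suits induction better than the [take] form of [regular_seq].
    Properness of the final ideal is left out, so that every sequence qualifies modulo the unit
    ideal, where the induction along a shelling starts. *)
Fixpoint weakly_regular I fs : Prop :=
  if fs is f :: fs' then regular_mod I f /\ weakly_regular (adj I f) fs'
  else True.

(** Ideals are predicates; turning equivalent ones into equal ones allows rewriting an ideal inside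
    [weakly_regular] and [ideal_add]. *)
Lemma pred_ext (T : Type) (I J : T -> Prop) : (forall t, I t <-> J t) -> I = J.
Proof.
by move=> e; apply: functional_extensionality => t; apply: propositional_extensionality.
Qed.

Lemma idealN I f : is_ideal I -> I f -> I (- f).
Proof. by case=> _ _ h /(h (-1)); rewrite mulN1r. Qed.

Lemma idealB I f g : is_ideal I -> I f -> I g -> I (f - g).
Proof. by move=> hI fI gI; case: (hI) => _ hD _; apply: hD => //; apply: idealN. Qed.

Lemma ideal_sum I (T : Type) (r : seq T) (p : pred T) (F : T -> {mpoly K[n]}) :
  is_ideal I -> (forall i, p i -> I (F i)) -> I (\sum_(i <- r | p i) F i).
Proof. by case=> h0 hD _ h; elim/big_ind: _. Qed.

Lemma adj_ideal I u : is_ideal I -> is_ideal (adj I u).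
Proof.
case=> h0 hD hM; split.
- by exists 0; rewrite mul0r subr0.
- move=> f g [c hc] [e he]; exists (c + e).
  by have := hD _ _ hc he; congr I; ring.
- move=> a f [c hc]; exists (a * c).
  by have := hM a _ hc; congr I; ring.
Qed.

Lemma sub_adj I u f : I f -> adj I u f.
Proof. by exists 0; rewrite mul0r subr0. Qed.

Lemma mem_adj I u c : is_ideal I -> adj I u (c * u).
Proof. by case=> h0 _ _; exists c; rewrite subrr. Qed.

Lemma adjC I u f : adj (adj I u) f = adj (adj I f) u.
Proof.
apply: pred_ext => g; split=> -[c [e h]]; exists e, c; move: h; congr I; ring.
Qed.

Lemma homog_idealP I f : homog_ideal I ->
  (forall d, I (pihomog mdeg d f)) -> I f.
Proof.
move=> [hI _] h; rewrite (pihomog_partitionE (leqnn (msize f))).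
exact: ideal_sum.
Qed.

Lemma pihomogM_homog (d e : nat) f u : u \is d.-homog ->
  pihomog mdeg (e + d) (f * u) = pihomog mdeg e f * u.
Proof.
move=> hu; elim/mpolyind: f => [|c m f _ _ IH]; first by rewrite mul0r !raddf0 mul0r.
rewrite mulrDl !raddfD /= IH mulrDl; congr (_ + _).
rewrite -scalerAl !linearZ /= -scalerAl; congr (_ *: _).
have hM : 'X_[m] * u \is (mdeg m + d).-homog.
  by apply: dhomogM => //; rewrite dhomogX.
rewrite pihomogX; case: (eqVneq (mdeg m) e) => [<-|ne]; first by rewrite pihomog_dE.
by rewrite mul0r (pihomog_ne0 _ hM) // eqn_add2r.
Qed.

Lemma pihomogM_lt (d e : nat) f u : u \is d.-homog -> (e < d)%N ->
  pihomog mdeg e (f * u) = 0.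
Proof.
move=> hu ed; elim/mpolyind: f => [|c m f _ _ IH]; first by rewrite mul0r raddf0.
rewrite mulrDl raddfD /= IH addr0 -scalerAl linearZ /=.
have hM : 'X_[m] * u \is (mdeg m + d).-homog.
  by apply: dhomogM => //; rewrite dhomogX.
rewrite (pihomog_ne0 _ hM) ?scaler0 //.
by apply: contraTneq ed => <-; rewrite -leqNgt leq_addl.
Qed.

(** The degree e component of f - c u involves only the degree e - d component of c, and no multiple
    of u at all when e < d. *)
Lemma adj_homog I u (d : nat) : homog_ideal I -> u \is d.-homog ->
  homog_ideal (adj I u).
Proof.
move=> [hI hh] hu; split; first exact: adj_ideal.
move=> e f [c /(hh e)]; rewrite raddfB /= => h.
have [de|ed] := leqP d e.
  by exists (pihomog mdeg (e - d) c); rewrite -(pihomogM_homog _ _ hu) subnK.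
by move: h; rewrite (pihomogM_lt _ hu ed) subr0 => h; exact: sub_adj.
Qed.

Lemma ideal_add_nil I : ideal_add I [::] = I.
Proof.
apply: pred_ext => f; rewrite /ideal_add; split=> [[c]|h].
  by rewrite big_ord0 subr0.
by exists (fun=> 0); rewrite big_ord0 subr0.
Qed.

Lemma ideal_add_cons I u fs : ideal_add I (u :: fs) = ideal_add (adj I u) fs.
Proof.
apply: pred_ext => f; rewrite /ideal_add; split.
  move=> [c]; rewrite big_ord_recl /= => h.
  exists (fun i => c (lift ord0 i)), (c ord0).
  by move: h; congr I; rewrite opprD addrA addrAC.
move=> [c [e h]].
exists (fun i : 'I_(size (u :: fs)) => if unlift ord0 i is Some j then c j else e).
rewrite big_ord_recl /= unlift_none.
under eq_bigr do rewrite liftK.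
by move: h; congr I; rewrite opprD addrA addrAC.
Qed.

Lemma regular_seqE I fs :
  regular_seq I fs <-> weakly_regular I fs /\ ~ ideal_add I fs 1.
Proof.
suff e : (forall i, (i < size fs)%N -> regular_mod (ideal_add I (take i fs)) fs`_i)
    <-> weakly_regular I fs.
  by split=> -[h1 h2]; split=> //; apply/e.
elim: fs I => [|f fs IH] I //=; split.
  move=> h; split; first by have := h 0 isT; rewrite /= ideal_add_nil.
  by apply/IH => i hi; have := h i.+1 hi; rewrite /= ideal_add_cons.
move=> [hf /IH h] [|i] hi /=; first by rewrite ideal_add_nil.
by rewrite ideal_add_cons; apply: h.
Qed.

Lemma weakly_regular_rcons I fs u :
  weakly_regular I (rcons fs u) <->
  weakly_regular I fs /\ regular_mod (ideal_add I fs) u.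
Proof.
elim: fs I => [|f fs IH] I /=; first by rewrite ideal_add_nil; tauto.
by rewrite IH ideal_add_cons; tauto.
Qed.

Lemma ideal_addP I fs : is_ideal I -> is_ideal (ideal_add I fs).
Proof.
elim: fs I => [|f fs IH] I hI; first by rewrite ideal_add_nil.
by rewrite ideal_add_cons; apply/IH/adj_ideal.
Qed.

Lemma sub_ideal_add I fs f : I f -> ideal_add I fs f.
Proof.
elim: fs I => [|g fs IH] I hI; first by rewrite ideal_add_nil.
by rewrite ideal_add_cons; apply/IH/sub_adj.
Qed.

(* The sequence is regular on the outer terms of
   0 -> R/(I : u) -> R/I -> R/(I + u) -> 0, hence on the middle one. *)
Lemma weakly_regular_ext I u fs : is_ideal I ->
  weakly_regular (fun b => I (b * u)) fs -> weakly_regular (adj I u) fs ->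
  weakly_regular I fs.
Proof.
elim: fs I => [//|f fs IH] I hI /= [rP wP] [rA wA].
have rI : regular_mod I f.
  move=> g fgI; have /rA[b hb] : adj I u (f * g) by exact: sub_adj.
  have : I (f * b * u).
    have := idealB hI fgI (let: And3 _ _ h := hI in h f _ hb).
    by congr I; ring.
  rewrite -mulrA => h; have /rP h' : I (f * b * u) by rewrite -mulrA.
  by case: hI => _ hD _; have := hD _ _ hb h'; congr I; ring.
split=> //; apply: IH; first exact: adj_ideal; last by rewrite adjC.
(* Here (I + (f)) : u = (I : u) + (f). If b u = c f modulo I, regularity of f modulo I + (u) gives c
   = e u modulo I, whence (b - e f) u lies in I. *)
suff -> : (fun b => adj I f (b * u)) = adj (fun b => I (b * u)) f by [].
apply: pred_ext => b; split=> [[c hc]|[c hc]]; last first.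
  by exists (c * u); move: hc; congr I; ring.
have /rA[e he] : adj I u (f * c).
  exists b; have := idealN hI hc; congr I; ring.
exists e; case: (hI) => _ hD hM.
by have := hD _ _ hc (hM f _ he); congr I; ring.
Qed.

Lemma homog_mulr_mem I (d : nat) u f :
  homog_ideal I -> u \is d.-homog -> I (u * f) ->
  forall e, I (u * pihomog mdeg e f).
Proof.
move=> [_ hh] hu /(hh _) h e.
by have := h (e + d)%N; rewrite mulrC pihomogM_homog // mulrC.
Qed.

(* If f g in I then g in I + (x), say g = x g' modulo I, and f g' in I since x
   is regular; homogeneity makes the degree drop, so this descent ends. *)
Lemma regular_mod_swap I (i : 'I_n) (d : nat) f :
  homog_ideal I -> f \is d.-homog ->
  regular_mod I 'X_i -> regular_mod (adj I 'X_i) f ->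
  regular_mod I f.
Proof.
move=> hI hf rx rf g fg; have [hid hh] := hI; have [_ hD hM] := hid.
apply: homog_idealP => // e.
have {fg} : I (f * pihomog mdeg e g) by apply: homog_mulr_mem hf _ _.
move: (pihomog mdeg e g) (pihomogP mdeg e g) => {}g.
elim: e g => [|e IH] g hg fg; have [c] := rf _ (sub_adj 'X_i fg).
  move/(hh 0); rewrite raddfB /= pihomog_dE // (@pihomogM_lt 1) ?subr0 //.
  by rewrite dhomogX /= mdeg1.
move/(hh e.+1); rewrite raddfB /= pihomog_dE // -addn1 (@pihomogM_homog 1); last first.
  by rewrite dhomogX /= mdeg1.
set c' := pihomog mdeg e c => hc.
suff c'I : I c' by have := hD _ _ hc (hM 'X_i _ c'I); congr I; ring.
apply: IH; first exact: pihomogP.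
by apply: rx; have := idealB hid fg (hM f _ hc); congr I; ring.
Qed.

(** Permutability of homogeneous regular sequences: [regular_mod_swap] moves the variable from the
    front to the end, past one element of [fs] at a time. *)
Lemma weakly_regular_swap I (i : 'I_n) (ds : nat -> nat) fs :
  homog_ideal I -> (forall k, (k < size fs)%N -> fs`_k \is (ds k).-homog) ->
  regular_mod I 'X_i -> weakly_regular (adj I 'X_i) fs ->
  weakly_regular I fs /\ regular_mod (ideal_add I fs) 'X_i.
Proof.
elim: fs I ds => [|f fs IH] I ds hI hfs rx /=; first by rewrite ideal_add_nil.
have hf : f \is (ds 0%N).-homog by apply: (hfs 0%N).
case=> rf; rewrite adjC ideal_add_cons => w.
have rI := regular_mod_swap hI hf rx rf.
suff: weakly_regular (adj I f) fs /\ regular_mod (ideal_add (adj I f) fs) 'X_i.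
  by case=> w' r'; split.
apply: (IH _ (fun k => ds k.+1)) => //; first exact: adj_homog hf.
  by move=> k hk; apply: (hfs k.+1).
have [[_ hD hM] _] := hI.
(* From x_i g = b f modulo I, regularity of f modulo I + (x_i) gives b = a x_i modulo I, and
   cancelling x_i gives g = a f modulo I. *)
move=> g [b hb]; have /rf[a ha] : adj I 'X_i (f * b).
  by exists g; have := idealN (proj1 hI) hb; congr I; ring.
exists a; apply: rx; have := hD _ _ hb (hM f _ ha); congr I; ring.
Qed.

End Ideals.

(** * Squarefree monomial ideals *)

Section MonomialIdeals.
Import GRing.Theory.
Local Open Scope ring_scope.
Variables (K : fieldType) (n : nat).
Implicit Types (f g b : {mpoly K[n]}) (A B F : {set 'I_n}) (Q : pred {set 'I_n})
  (m : 'X_{1..n}).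

Definition msupport m : {set 'I_n} := [set i | m i != 0%N].

Definition xset A : {mpoly K[n]} := 'X_[mesym1 A].

(* The Stanley-Reisner ideal of the complex of the sets satisfying [Q]. *)
Definition mono_ideal Q f : Prop := forall m, m \in msupp f -> ~~ Q (msupport m).

Definition down_closed Q : Prop := forall A B, A \subset B -> Q B -> Q A.

Lemma msupportD m1 m2 : msupport (m1 + m2)%MM = msupport m1 :|: msupport m2.
Proof. by apply/setP => i; rewrite !inE mnmDE addn_eq0 negb_and. Qed.

Lemma msupport_mesym1 A : msupport (mesym1 A) = A.
Proof. by apply/setP => i; rewrite !inE mnmE; case: (i \in A). Qed.

Lemma mesym1_le A m : A \subset msupport m -> ((m - mesym1 A) + mesym1 A)%MM = m.
Proof.
move=> /subsetP h; apply: submK; apply/mnm_lepP => i; rewrite mnmE.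
by case: (boolP (i \in A)) => // /h; rewrite inE lt0n.
Qed.

Lemma xset1 i : xset [set i] = 'X_i.
Proof. by rewrite /xset mesym1_set1. Qed.

Lemma mono_idealP Q : down_closed Q -> homog_ideal (mono_ideal Q).
Proof.
move=> dQ; split; first split.
- by move=> m; rewrite msupp0.
- by move=> f g hf hg m /msuppD_le; rewrite mem_cat => /orP[/hf|/hg].
- move=> c f hf m /msuppM_le /allpairsP[[m1 m2] /= [_ /hf + ->]].
  by rewrite msupportD; apply: contra; apply: dQ; rewrite subsetUr.
- move=> d f hf m; rewrite pihomogE => /msupp_sum_le /flatten_mapP[m'].
  rewrite mem_filter => /andP[_ m'f] /msuppZ_le.
  by rewrite msuppX inE => /eqP ->; apply: hf.
Qed.

(** The colon ideal by x_A is again squarefree monomial: multiplication by x_A shifts the monomials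
    of [b] bijectively and adds A to each support. *)
Lemma mono_idealMxset Q A b :
  mono_ideal Q (b * xset A) <-> mono_ideal (fun B => Q (A :|: B)) b.
Proof.
split=> h m mb.
  have := h (mesym1 A + m)%MM; rewrite msupportD msupport_mesym1; apply.
  by rewrite (perm_mem (msuppMX _ _)) map_f.
move: mb; rewrite (perm_mem (msuppMX _ _)) => /mapP[m' /h + ->].
by rewrite msupportD msupport_mesym1.
Qed.

(** Division with remainder by x_A: the quotient collects the terms divisible by x_A, which are
    those whose support contains A. *)
Lemma xset_div A f : exists c, forall m, m \in msupp (f - c * xset A) ->
  m \in msupp f /\ ~~ (A \subset msupport m).
Proof.
exists (\sum_(m <- msupp f | A \subset msupport m) f@_m *: 'X_[m - mesym1 A]) => m.
rewrite {1}[f]mpolyE (bigID (fun m => A \subset msupport m)) /= mulr_suml.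
set S := (X in X + _ - _); set T := (X in _ - X).
have -> : T = S.
  apply: eq_bigr => m' h; rewrite -scalerAl -mpolyXD mesym1_le //.
rewrite addrAC subrr add0r => /msupp_sum_le /flatten_mapP[m'].
rewrite mem_filter => /andP[h m'f] /msuppZ_le.
by rewrite msuppX inE => /eqP ->.
Qed.

Lemma mono_ideal_adj Q A : down_closed Q ->
  adj (mono_ideal Q) (xset A) = mono_ideal (fun B => Q B && ~~ (A \subset B)).
Proof.
move=> dQ; apply: pred_ext => f; split=> [[c hc]|h]; last first.
  have [c hc] := xset_div A f; exists c => m /hc[/h + hA].
  by rewrite hA andbT.
have dQ' : down_closed (fun B => Q B && ~~ (A \subset B)).
  move=> B C BC /andP[QC nAC]; rewrite (dQ _ _ BC) //=.
  by apply: contra nAC => /subset_trans; apply.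
have [[_ hD _] _] := mono_idealP dQ'.
rewrite -(subrK (c * xset A) f); apply: hD.
  by move=> m /hc; apply: contra => /andP[].
by apply/mono_idealMxset => m _; rewrite subsetUl andbF.
Qed.

Lemma xsetE A : xset A = \prod_(i in A) 'X_i.
Proof.
rewrite mprodXE; congr 'X_[_]; apply/mnmP => i; rewrite mnmE mnm_sumE big_mkcond /=.
rewrite (bigD1 i) //= mnmE eqxx big1 ?addn0; first by case: (i \in A).
by move=> j ji; rewrite mnmE (negbTE ji); case: (j \in A).
Qed.

Lemma stanley_reisnerE (D : {set {set 'I_n}}) :
  down_closed (mem D) -> stanley_reisner (K := K) D = mono_ideal (mem D).
Proof.
move=> dD; have [hI _] := mono_idealP dD.
apply: pred_ext => f; split=> [[c ->]|h].
  apply: ideal_sum => // A nA; rewrite -xsetE; apply/mono_idealMxset => m _.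
  by apply: contra nA; apply: dD; apply: subsetUl.
(* The nonface A receives only the terms with support exactly A, so that each term of [f] is counted
   once. *)
exists (fun A => \sum_(m <- msupp f | msupport m == A) f@_m *: 'X_[m - mesym1 A]).
rewrite [LHS]mpolyE.
transitivity (\sum_(A : {set 'I_n} | A \notin D)
    \sum_(m <- msupp f | msupport m == A) f@_m *: 'X_[m] : {mpoly K[n]}); last first.
  apply: eq_bigr => A _; rewrite mulr_suml; apply: eq_bigr => m /eqP mA.
  by rewrite -xsetE -scalerAl -mpolyXD mesym1_le ?mA.
rewrite (exchange_big_dep predT) //= big_seq [RHS]big_seq.
apply: eq_bigr => m /h mD; rewrite (big_pred1 (msupport m)) // => A /=.
by rewrite [_ == A]eq_sym andb_idl // => /eqP ->.
Qed.

(** * Face primes and elementary symmetric polynomials *)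

(** The prime P_F generated by the variables outside F. *)
Definition face_prime F := mono_ideal (fun A => A \subset F).

Lemma face_prime_homog F : homog_ideal (face_prime F).
Proof. by apply: mono_idealP => A B; apply: subset_trans. Qed.

Lemma face_prime_adj F i : i \in F -> adj (face_prime F) 'X_i = face_prime (F :\ i).
Proof.
move=> iF; rewrite -xset1 mono_ideal_adj; last by move=> A B; apply: subset_trans.
by congr mono_ideal; apply: functional_extensionality => B; rewrite sub1set subsetD1.
Qed.

Lemma face_prime_regular F i : i \in F -> regular_mod (face_prime F) 'X_i.
Proof.
move=> iF g; rewrite mulrC -xset1 => /mono_idealMxset h m /h.
by rewrite subUset sub1set iF.
Qed.

Lemma regular_mod_prod (I : {mpoly K[n]} -> Prop) (r : seq 'I_n) :
  (forall i, i \in r -> regular_mod I 'X_i) ->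
  regular_mod I (\prod_(i <- r) 'X_i).
Proof.
elim: r => [|i r IH] h g; first by rewrite big_nil mul1r.
rewrite big_cons -mulrA => /(h i (mem_head _ _)); apply: IH => j jr.
by apply: h; rewrite inE jr orbT.
Qed.

Definition mesyms d : seq {mpoly K[n]} := mkseq (fun k => mesym n K k.+1) d.

(** A set of size |F| other than F is not contained in F, so its monomial vanishes modulo P_F and
    only x_F survives. *)
Lemma mesym_face_prime F : face_prime F (mesym n K #|F| - xset F).
Proof.
rewrite /xset mesymE (bigD1 F) //= addrAC subrr add0r.
have [hI _] := face_prime_homog F.
apply: ideal_sum => // A /andP[/eqP cA AF] m.
rewrite msuppX inE => /eqP ->; rewrite msupport_mesym1.
by apply: contra AF => AF; rewrite eqEcard AF cA leqnn.
Qed.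

(* The coordinate ring of the simplex F modulo x_i is that of F minus i; once
   as many symmetric functions as variables are used, the last one is the
   product of the variables. *)
Lemma mesyms_face_prime F d : (d <= #|F|)%N ->
  weakly_regular (face_prime F) (mesyms d).
Proof.
move: {2}#|F| (leqnn #|F|) => N; elim: N F d => [|N IH] F d FN dF.
  by move: (leq_trans dF FN); rewrite leqn0 => /eqP ->.
(* Modulo x_i the claim is the inductive one for F minus i, which needs k < |F|;
   [weakly_regular_swap] then lifts it to P_F. *)
have swap i k : i \in F -> (k < #|F|)%N ->
    weakly_regular (face_prime F) (mesyms k) /\
    regular_mod (ideal_add (face_prime F) (mesyms k)) 'X_i.
  move=> iF kF; apply: (weakly_regular_swap (ds := succn)).
  - exact: face_prime_homog.
  - by move=> j; rewrite size_mkseq => jk; rewrite nth_mkseq // dhomog_mesym.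
  - exact: face_prime_regular.
  - rewrite face_prime_adj //.
    have e := cardsD1 i F; rewrite iF add1n in e; rewrite e in FN kF.
    exact: IH.
case: d dF => [//|d] dF; have /card_gt0P[i iF] := leq_ltn_trans (leq0n d) dF.
(* Below the top length [swap] suffices. At the top, the last element is x_F modulo P_F, and every
   variable of F is regular after the earlier ones. *)
move: (dF); rewrite leq_eqVlt => /orP[/eqP e|/(swap i _ iF)[] //].
rewrite /mesyms mkseqS; apply/weakly_regular_rcons.
split; first by have [] := swap i _ iF dF.
rewrite e => g h.
have hI : is_ideal (ideal_add (face_prime F) (mesyms d)).
  by apply: ideal_addP; have [] := face_prime_homog F.
have hs := sub_ideal_add (mesyms d) (@mesym_face_prime F).
apply: (@regular_mod_prod _ (enum F)) => [j|].
  by rewrite mem_enum => jF; have [] := swap j _ jF dF.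
rewrite big_enum /= -xsetE; have [_ _ hM] := hI.
by have := idealB hI h (hM g _ hs); congr (ideal_add _ _ _); ring.
Qed.

Lemma weakly_regular_triv (I : {mpoly K[n]} -> Prop) fs :
  (forall f, I f) -> weakly_regular I fs.
Proof.
elim: fs I => [|f fs IH] I h //=; split; first by move=> g _.
by apply: IH => g; apply: sub_adj.
Qed.

(** * Regular sequences along a shelling *)

Definition subface (s : seq {set 'I_n}) : pred {set 'I_n} :=
  fun A => has (fun F => A \subset F) s.

Lemma subface_down_closed s : down_closed (subface s).
Proof.
move=> A B AB /hasP[F Fs BF]; apply/hasP; exists F => //.
exact: subset_trans BF.
Qed.

(** The exchange condition of [shellable] on its own, which passes to initial segments of the
    order. *)
Definition shelling (s : seq {set 'I_n}) : Prop :=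
  forall i j : nat, (i < j)%N -> (j < size s)%N ->
        exists v : 'I_n,
          v \in nth set0 s j :\: nth set0 s i /\
          (exists l : nat, (l < j)%N /\
             nth set0 s j :\: nth set0 s l = [set v]).

(* R is the restriction of F: the faces of F that are new are those containing
   R, so that adding F to the complex replaces I + (x_R) by I, where I : x_R is
   the prime of F. *)
Lemma shelling_regular s d : shelling s -> (forall F, F \in s -> (d <= #|F|)%N) ->
  weakly_regular (mono_ideal (subface s)) (mesyms d).
Proof.
elim/last_ind: s => [|s F IH] sh hd; first by apply: weakly_regular_triv => f m.
have {IH} w : weakly_regular (mono_ideal (subface s)) (mesyms d).
  apply: IH => [i j ij js|G Gs]; last by apply: hd; rewrite mem_rcons inE Gs orbT.
  have [] := sh i j ij; first by rewrite size_rcons ltnW.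
  rewrite !nth_rcons js (ltn_trans ij js) => v [hv [l [lj hl]]]; exists v.
  by split=> //; exists l; move: hl; rewrite nth_rcons (ltn_trans lj js).
have step G : G \in s ->
    exists v, v \in F :\: G /\ exists2 H, H \in s & F :\: H = [set v].
  move=> Gs; have Gi : (index G s < size s)%N by rewrite index_mem.
  have [] := sh (index G s) (size s) Gi; first by rewrite size_rcons.
  move=> v []; rewrite !nth_rcons Gi ltnn eqxx nth_index // => hv [l [ls]].
  rewrite nth_rcons ls => hl; exists v; split=> //.
  by exists (nth set0 s l) => //; apply: mem_nth.
pose R := [set v in F | subface s (F :\ v)].
have RF : R \subset F by apply/subsetP => v; rewrite inE => /andP[].
(* If R and hence A lay in an earlier G, the exchange vertex v outside G, with F minus H equal to
   {v}, would satisfy v in R: a contradiction. *)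
have newE A : R \subset A -> subface s A = false.
  move=> RA; apply/hasP => -[G Gs AG].
  have [v [+ [H Hs e]]] := step G Gs; rewrite inE => /andP[/negP vG vF].
  apply: vG; apply: (subsetP (subset_trans RA AG)); rewrite inE vF /=.
  apply/hasP; exists H => //; apply/subsetP => x; rewrite !inE => /andP[xv xF].
  by apply: contraR xv => xH; rewrite -in_set1 -e inE xH.
(* A face of F missing some v of R lies in F minus v, which is an old face. *)
have oldE A : A \subset F -> ~~ (R \subset A) -> subface s A.
  move=> AF /subsetPn[v]; rewrite inE => /andP[vF h] vA.
  by apply: subface_down_closed h; rewrite subsetD1 AF.
have subE A : subface (rcons s F) A = (A \subset F) || subface s A.
  by rewrite /subface has_rcons.
have dS := @subface_down_closed (rcons s F).
apply: (weakly_regular_ext (u := xset R)).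
- by have [] := mono_idealP dS.
- suff -> : (fun b => mono_ideal (subface (rcons s F)) (b * xset R)) = face_prime F.
    by apply: mesyms_face_prime; apply: hd; rewrite mem_rcons mem_head.
  apply: pred_ext => b; rewrite mono_idealMxset.
  have e A : subface (rcons s F) (R :|: A) = (A \subset F).
    by rewrite subE newE ?subsetUl // orbF subUset RF.
  by split=> h m /h; rewrite e.
- rewrite mono_ideal_adj //; move: w; congr (weakly_regular (mono_ideal _) _).
  apply: functional_extensionality => A; rewrite subE.
  have [RA|RA] := boolP (R \subset A); first by rewrite newE // andbF.
  by rewrite andbT; case: (boolP (A \subset F)) => //= AF; rewrite oldE.
Qed.

End MonomialIdeals.

(** * Minimal free resolutions *)

Section Resolutions.
Import GRing.Theory.
Local Open Scope ring_scope.
Variables (K : fieldType) (n : nat).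
Implicit Types (I J : {mpoly K[n]} -> Prop) (f g u : {mpoly K[n]})
  (F : {set 'I_n}).

Lemma sub_mxE p q (A B : 'M[{mpoly K[n]}]_(p, q)) i j : (A - B) i j = A i j - B i j.
Proof. by rewrite !mxE. Qed.

Lemma sub_scale_mxE p q c (A B : 'M[{mpoly K[n]}]_(p, q)) i j :
  (A - c *: B) i j = A i j - c * B i j.
Proof. by rewrite !mxE. Qed.

Definition row_in J r (v : 'rV[{mpoly K[n]}]_r) : Prop := forall l, J (v 0 l).

Lemma row_inD J r (v w : 'rV[{mpoly K[n]}]_r) : is_ideal J ->
  row_in J v -> row_in J w -> row_in J (v + w).
Proof. by case=> _ hD _ hv hw l; rewrite mxE; apply: hD. Qed.

Lemma row_inZ J c r (v : 'rV[{mpoly K[n]}]_r) : is_ideal J ->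
  row_in J v -> row_in J (c *: v).
Proof. by case=> _ _ hM hv l; rewrite mxE; apply: hM. Qed.

Lemma row_inN J r (v : 'rV[{mpoly K[n]}]_r) : is_ideal J ->
  row_in J v -> row_in J (- v).
Proof. by move=> hJ hv l; rewrite mxE; apply: idealN. Qed.

Lemma row_inM J r s (v : 'rV[{mpoly K[n]}]_r) (M : 'M_(r, s)) : is_ideal J ->
  row_in J v -> row_in J (v *m M).
Proof.
move=> hJ hv l; rewrite mxE; apply: ideal_sum => // k _.
by rewrite mulrC; case: hJ => _ _; apply.
Qed.

Lemma row_in_adj J u r (v : 'rV[{mpoly K[n]}]_r) :
  row_in (adj J u) v <-> exists w, row_in J (v - u *: w).
Proof.
split=> [/fin_all_exists[c hc]|[w hw] l].
  by exists (\row_l c l) => l; rewrite !mxE mulrC.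
by exists (w 0 l); have := hw l; rewrite !mxE mulrC.
Qed.

Lemma row_in_regular J u r (v : 'rV[{mpoly K[n]}]_r) :
  regular_mod J u -> row_in J (u *: v) -> row_in J v.
Proof. by move=> h hv l; apply: h; have := hv l; rewrite mxE. Qed.

(** Degrees are dropped because cones are taken over arbitrary regular sequences in the irrelevant
    ideal, whose members may be inhomogeneous. *)
Definition min_free_res (r : nat -> nat)
    (d : forall i, 'M[{mpoly K[n]}]_(r i.+1, r i)) (a : 'cV[{mpoly K[n]}]_(r 0))
    J : Prop :=
  [/\ forall f, exists v : 'rV_(r 0), J (f - (v *m a) 0 0),
      forall v : 'rV_(r 0), J ((v *m a) 0 0) <-> exists w, v = w *m d 0,
      forall i (v : 'rV_(r i.+1)), v *m d i = 0 <-> exists w, v = w *m d i.+1 &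
      forall i k l, irrelevant (d i k l)].

(** This and [face_prime0] are the two ends of the chain of P_F along which variables are killed one
    at a time: the zero ideal and the irrelevant ideal. *)
Lemma face_primeT f : face_prime setT f -> f = 0.
Proof.
move=> h; apply: msuppnil0; move: h; rewrite /face_prime /mono_ideal.
by case: (msupp f) => // m s /(_ m (mem_head _ _)); rewrite subsetT.
Qed.

Lemma face_prime0 f : irrelevant f <-> face_prime set0 f.
Proof.
split=> [h m|h]; last first.
  apply/eqP; rewrite mcoeff_eq0; apply/negP => /h.
  by rewrite subset0; case/eqP; apply/setP => i; rewrite !inE mnm0E.
rewrite mcoeff_msupp subset0; apply: contra => /eqP e.
suff -> : m = 0%MM by rewrite h.
by apply/mnmP => i; rewrite mnm0E; apply/eqP; have := in_set0 i; rewrite -e inE => /negbFE.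
Qed.

Lemma irrelevant_ideal : is_ideal (@irrelevant K n).
Proof.
have -> : @irrelevant K n = face_prime set0 by apply: pred_ext => f; apply: face_prime0.
by have [] := face_prime_homog K (set0 : {set 'I_n}).
Qed.

(** * Killing variables in a minimal resolution *)

Section Fixed.
Variables (r : nat -> nat) (d : forall i, 'M[{mpoly K[n]}]_(r i.+1, r i)).
Variables (a : 'cV[{mpoly K[n]}]_(r 0)) (J : {mpoly K[n]} -> Prop).
Hypothesis hres : min_free_res d a J.

Lemma res_dd i : d i.+1 *m d i = 0.
Proof.
have [_ _ ex _] := hres; apply/row_matrixP => k; rewrite row0 row_mul.
by apply/ex; exists (delta_mx 0 k); rewrite rowE.
Qed.

(* Reduction modulo a variable raises by one the degree from which the complex
   is exact. *)
Lemma res_exact_mod F i (v : 'rV_(r i.+1)) : (#|~: F| <= i)%N ->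
  row_in (face_prime F) (v *m d i) ->
  exists w, row_in (face_prime F) (v - w *m d i.+1).
Proof.
have [_ _ ex _] := hres.
move: {2}#|~: F| (erefl #|~: F|) => k; elim: k F i v => [|k IH] F i v.
  move/eqP; rewrite cards_eq0 => /eqP e _.
  have -> : F = setT by rewrite -[F]setCK e setC0.
  move=> h; have /ex[w ->] : v *m d i = 0.
    by apply/rowP => l; rewrite [RHS]mxE; apply: face_primeT.
  exists w => l; rewrite subrr mxE.
  by have [[]] := face_prime_homog K (setT : {set 'I_n}).
move=> e; have /card_gt0P[j] : (0 < #|~: F|)%N by rewrite e.
rewrite inE => jF; set F' := j |: F.
have FF' : F = F' :\ j by rewrite setU1K.
have jF' : j \in F' by rewrite setU11.
have e' : #|~: F'| = k.
  by apply: succn_inj; rewrite -e [in RHS](cardsD1 j) !inE jF setCU setIC -setDE.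
have [hP _] := face_prime_homog K F'.
have rX := @face_prime_regular K _ _ _ jF'.
rewrite FF' -face_prime_adj // -FF' e => ki.
case: i ki v => [//|i] ki v /row_in_adj[u hu].
(* Here v d = x_j u modulo P_F'. Cancelling x_j shows that u is a cycle, so u = w d, and then v -
   x_j w is a cycle modulo P_F'. *)
have [||w hw] := IH F' i u e'; first by rewrite e'.
  apply: row_in_regular rX _; rewrite scalemxAl.
  have := row_inN hP (row_inM (d i) hP hu).
  by rewrite mulmxBl -mulmxA res_dd mulmx0 sub0r opprK.
have [||z hz] := IH F' i.+1 (v - 'X_j *: w) e'.
- by rewrite e' ltnW.
- have := row_inD hP hu (row_inZ 'X_j hP hw); congr row_in.
  by rewrite mulmxBl -scalemxAl scalerBr addrA subrK.
exists z; apply/row_in_adj; exists w.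
by move: hz; rewrite addrAC.
Qed.

(** Hilbert's bound: modulo all variables the complex is exact beyond degree n by [res_exact_mod],
    while minimality makes its maps zero there. *)
Lemma res_length i : (n < i)%N -> r i = 0%N.
Proof.
case: i => // i; rewrite ltnS => ni; have [_ _ ex mi] := hres.
case e : (r i.+1) => [//|r']; have k : 'I_(r i.+1) by rewrite e; exact: ord0.
have [hP _] := face_prime_homog K (set0 : {set 'I_n}).
have dI s t (v : 'rV_s) (M : 'M_(s, t)) : (forall k l, irrelevant (M k l)) ->
    row_in (face_prime set0) (v *m M).
  move=> hM l; rewrite mxE; apply: ideal_sum => // m _.
  by case: hP => _ _; apply; apply/face_prime0.
have [||w hw] := @res_exact_mod set0 i (delta_mx 0 k).
- by rewrite setC0 cardsT card_ord.
- exact: dI.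
have := row_inD hP hw (dI _ _ w _ (mi i.+1)); rewrite subrK => /(_ k).
by rewrite mxE !eqxx => /face_prime0; rewrite /irrelevant mcoeff1 eqxx => /eqP; rewrite oner_eq0.
Qed.

(** Starting from the class of u in R/J, each variable outside F that is killed turns a nonzero
    class annihilated by these variables into one a degree higher, through the connecting map of
    multiplication by that variable. *)
Lemma res_rank_facet F u : is_ideal J -> ~ J u ->
  (forall j, j \notin F -> J ('X_j * u)) -> r #|~: F| <> 0%N.
Proof.
move=> hJ Ju hu; have [su au ex _] := hres.
suff H k (E : {set 'I_n}) : k = #|~: E| -> F \subset E ->
    exists v : 'rV_(r k),
      ~ (exists w, row_in (face_prime E) (v - w *m d k)) /\
      forall j, j \notin F -> exists w, row_in (face_prime E) ('X_j *: v - w *m d k).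
  have [v [nv _]] := H _ _ erefl (subxx F).
  move=> e; apply: nv; exists 0; rewrite mul0mx subr0.
  by move=> l; have := ltn_ord l; rewrite [X in (_ < X)%N]e.
elim: k E => [|k IH] E.
  move/esym/eqP; rewrite cards_eq0 => /eqP e _.
have -> : E = setT by rewrite -[E]setCK e setC0.
  have [v hv] := su u; exists v.
  have [_ hD hM] := hJ.
  split=> [[w hw]|j jF].
    apply: Ju; rewrite -(subrK ((v *m a) 0 0) u); apply: hD => //.
    apply/au; exists w; apply/subr0_eq/rowP => l; rewrite [RHS]mxE.
    exact/face_primeT/hw.
  have /au[w hw] : J (('X_j *: v *m a) 0 0).
    have := idealB hJ (hu j jF) (hM 'X_j _ hv); congr J.
    by rewrite -scalemxAl [in RHS]mxE; ring.
  exists w => l; rewrite hw subrr mxE.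
  by have [[]] := face_prime_homog K (setT : {set 'I_n}).
move=> e; have /card_gt0P[j] : (0 < #|~: E|)%N by rewrite -e.
rewrite inE => jE FE; set E' := j |: E.
have EE' : E = E' :\ j by rewrite setU1K.
have jE' : j \in E' by rewrite setU11.
have e' : k = #|~: E'|.
  by apply: succn_inj; rewrite e (cardsD1 j) !inE jE setCU setIC -setDE.
have [hP _] := face_prime_homog K E'.
have rX := @face_prime_regular K _ _ _ jE'.
have [|v [nv hv]] := IH _ e'; first by apply: subset_trans FE (subsetUr _ _).
have jF : j \notin F by apply: contra jE; apply: (subsetP FE).
have [w hw] := hv j jF.
exists w; rewrite EE' -face_prime_adj //; split.
  move=> [z /row_in_adj[t ht]]; apply: nv; exists t; apply: row_in_regular rX _.
  have := row_inD hP hw (row_inM (d k) hP ht); congr row_in.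
  rewrite !mulmxBl -mulmxA res_dd mulmx0 subr0 addrA subrK scalerBr.
  by rewrite -scalemxAl.
move=> i /hv[t ht].
have [||z hz] := @res_exact_mod E' k ('X_i *: w - 'X_j *: t).
- by rewrite e'.
- have := row_inD hP (row_inZ 'X_j hP ht) (row_inN hP (row_inZ 'X_i hP hw)).
  congr row_in; rewrite mulmxBl !scalerBr -!scalemxAl !scalerA ['X_i * _]mulrC.
  by rewrite opprB addrC addrA subrK.
exists z; apply/row_in_adj; exists t; by move: hz; rewrite addrAC.
Qed.

End Fixed.

Section Cone.
Variables (r : nat -> nat) (d : forall i, 'M[{mpoly K[n]}]_(r i.+1, r i)).
Variables (f : {mpoly K[n]}).

Definition cone_rank i : nat := if i is i'.+1 then (r i + r i')%N else r 0.

Definition cone_map i : 'M[{mpoly K[n]}]_(cone_rank i.+1, cone_rank i) :=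
  if i is i'.+1 then block_mx (d i'.+1) 0 f%:M (- d i') else col_mx (d 0) f%:M.

Lemma cone_res (a : 'cV[{mpoly K[n]}]_(r 0)) J :
  is_ideal J -> irrelevant f -> regular_mod J f ->
  min_free_res d a J -> min_free_res cone_map (a : 'cV_(cone_rank 0)) (adj J f).
Proof.
move=> hJ f0 rf hres; have dd := res_dd hres.
have [su au ex mi] := hres; have [J0 hD hM] := hJ.
split=> /=.
- by move=> g; have [v hv] := su g; exists v; apply: sub_adj.
- move=> v; split=> [[c hc]|[w ->]].
    have [w hw] := su c.
    have /au[z hz] : J (((v - f *: w) *m a) 0 0).
      have := hD _ _ hc (hM f _ hw); congr J.
      by rewrite mulmxBl -scalemxAl sub_scale_mxE; ring.
    exists (row_mx z w); rewrite mul_row_col -hz mul_mx_scalar.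
    by rewrite subrK.
  rewrite -[w]hsubmxK mul_row_col mulmxDl mxE; apply: (let: And3 _ h _ := adj_ideal f hJ in h).
    by apply: sub_adj; apply/au; exists (lsubmx w).
  by rewrite mul_mx_scalar -scalemxAl mxE mulrC; apply: mem_adj.
- case=> [|i] v; rewrite -[v]hsubmxK; move: (lsubmx v) (rsubmx v) => {v} v w.
  + rewrite mul_row_col mul_mx_scalar; split=> [e|[z]].
      have /au[z hz] : J ((w *m a) 0 0).
        apply: rf; suff: J (((f *: w) *m a) 0 0) by rewrite -scalemxAl mxE.
        by apply/au; exists (- v); rewrite mulNmx; apply/eqP; rewrite -subr_eq0 opprK addrC e.
      have /ex[y hy] : (v + f *: z) *m d 0 = 0.
        by rewrite mulmxDl -scalemxAl -hz.
      exists (row_mx y (- z)); rewrite mul_row_block mulmx0 add0r mul_mx_scalar.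
      by rewrite mulNmx mulmxN opprK -hz -hy scalerN addrK.
    rewrite -[z]hsubmxK mul_row_block mulmx0 add0r mul_mx_scalar => /eq_row_mx[-> ->].
    by rewrite mulmxDl -mulmxA dd mulmx0 add0r mulmxN scalerN -scalemxAl subrr.
  + rewrite mul_row_block mul_mx_scalar mulmx0 add0r; split.
      rewrite -row_mx0 => /eq_row_mx[e1] /eqP.
      rewrite mulmxN oppr_eq0 => /eqP /ex[z hz].
      have /ex[y hy] : (v + f *: z) *m d i.+1 = 0.
        by rewrite mulmxDl -scalemxAl -hz.
      exists (row_mx y (- z)); rewrite mul_row_block mulmx0 add0r mul_mx_scalar.
      by rewrite mulNmx mulmxN opprK -hz -hy scalerN addrK.
    move=> [z]; rewrite -[z]hsubmxK mul_row_block mulmx0 add0r mul_mx_scalar => /eq_row_mx[-> ->].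
    rewrite !mulmxN mulNmx opprK mulmxDl -!mulmxA !dd !mulmx0 add0r scalerN.
    by rewrite -scalemxAl subrr row_mx0.
- have hf s (k l : 'I_s) : irrelevant ((f%:M : 'M_s) k l).
    by rewrite mxE; case: eqP => _; rewrite ?mulr1n // mulr0n /irrelevant mcoeff0.
  case=> [|i] k l; rewrite /cone_map !mxE; case: splitP => k' _ //; rewrite !mxE; case: splitP => l' _ //.
    by rewrite mxE /irrelevant mcoeff0.
  by rewrite mxE; apply: idealN => //; apply: irrelevant_ideal.
Qed.

End Cone.

Lemma res_length_regular r d a J i (fs : seq {mpoly K[n]}) :
  is_ideal J -> @min_free_res r d a J -> (forall f, f \in fs -> irrelevant f) ->
  weakly_regular J fs -> r i <> 0%N -> (i + size fs <= n)%N.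
Proof.
elim: fs J r d a i => [|f fs IH] J r d a i hJ hres hf /=.
  by move=> _ ri; rewrite addn0 leqNgt; apply/negP => /(res_length hres).
case=> rf w ri; rewrite addnS -addSn.
have f0 : irrelevant f by apply: hf; rewrite mem_head.
apply: (IH _ _ _ _ _ (adj_ideal f hJ) (cone_res hJ f0 rf hres)) => //.
  by move=> g gfs; apply: hf; rewrite inE gfs orbT.
by move=> /= /eqP; rewrite addn_eq0 => /andP[_ /eqP].
Qed.

End Resolutions.

(** * Graded maps and comparison of resolutions *)

Section Graded.
Import GRing.Theory.
Local Open Scope ring_scope.
Variables (K : fieldType) (n : nat).
Local Notation R := {mpoly K[n]}.
Implicit Types (p q : R) (I : R -> Prop).

(* The component of degree [e] of [p] seen in R(-s). *)
Definition hcomp (s e : nat) p : R := if (s <= e)%N then pihomog mdeg (e - s) p else 0.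

Lemma hcompD s e p q : hcomp s e (p + q) = hcomp s e p + hcomp s e q.
Proof. by rewrite /hcomp; case: ifP => _; rewrite ?raddfD ?addr0. Qed.

Lemma hcomp0 s e : hcomp s e 0 = 0.
Proof. by rewrite /hcomp; case: ifP => _; rewrite ?raddf0. Qed.

Lemma hcomp_supp s e p m : m \in msupp (hcomp s e p) -> (mdeg m + s = e)%N.
Proof.
rewrite /hcomp; case: ifP => [se|_]; last by rewrite msupp0.
by move/(dhomog_mf (pihomogP mdeg (e - s) p)) => /= ->; rewrite subnK.
Qed.

Lemma hcomp_id s e p : (forall m, m \in msupp p -> (mdeg m + s = e)%N) ->
  hcomp s e p = p.
Proof.
move=> h; have [->|p0] := eqVneq p 0; first exact: hcomp0.
have hp := h _ (mlead_supp p0).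
rewrite /hcomp -hp leq_addl addnK pihomog_dE //; apply/dhomogP => m /h e'.
by apply/eqP; rewrite -(eqn_add2r s) e' hp.
Qed.

Lemma hcompM s t e p q : (forall m, m \in msupp q -> (mdeg m + s = t)%N) ->
  hcomp s e (p * q) = hcomp t e p * q.
Proof.
move=> h; have [->|q0] := eqVneq q 0; first by rewrite !mulr0 hcomp0.
have hq := h _ (mlead_supp q0); set d := mdeg (mlead q) in hq.
have qd : q \is d.-homog.
  by apply/dhomogP => m /h e'; apply/eqP; rewrite -(eqn_add2r s) e' hq.
rewrite /hcomp -hq; case: (leqP (d + s) e) => de.
  rewrite (leq_trans (leq_addl _ _) de) -(pihomogM_homog _ _ qd).
  by rewrite [(d + s)%N]addnC subnDA subnK // leq_subRL ?(leq_trans (leq_addl _ _) de) // addnC.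
rewrite mul0r; case: ifP => // se; apply: (pihomogM_lt _ qd).
by rewrite ltn_subLR // addnC.
Qed.

Lemma hcomp_sum s M p : (msize p + s <= M)%N -> p = \sum_(e < M) hcomp s e p.
Proof.
move=> h; have sM := leq_trans (leq_addl _ _) h.
rewrite -(big_mkord xpredT (fun e => hcomp s e p)) (big_cat_nat (leq0n s) sM) //= big_nat.
rewrite big1 ?add0r => [|e /andP[_ es]]; last by rewrite /hcomp leqNgt es.
rewrite -{1}[s]add0n big_addn big_mkord {1}(@pihomog_partitionE _ _ mdeg (M - s) p).
  by apply: eq_bigr => e _; rewrite /hcomp leq_addl addnK.
by rewrite leq_subRL // addnC.
Qed.

Definition hrow r (deg : 'I_r -> nat) e (v : 'rV[R]_r) : 'rV[R]_r :=
  \row_l hcomp (deg l) e (v 0 l).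

(* A homogeneous map of degree 0 between graded free modules. *)
Definition hmx r s (degr : 'I_r -> nat) (degs : 'I_s -> nat) (M : 'M[R]_(r, s)) :=
  forall k l m, m \in msupp (M k l) -> (mdeg m + degs l = degr k)%N.

Lemma hrowM r s degr degs (M : 'M_(r, s)) e v : hmx degr degs M ->
  hrow degs e (v *m M) = hrow degr e v *m M.
Proof.
move=> hM; apply/rowP => l; rewrite !mxE.
rewrite (big_morph (hcomp (degs l) e) (hcompD _ _) (hcomp0 _ _)).
by apply: eq_bigr => k _; rewrite mxE; apply/hcompM/hM.
Qed.

Lemma hrow_id r s degr degs (M : 'M_(r, s)) k : hmx degr degs M ->
  hrow degs (degr k) (row k M) = row k M.
Proof. by move=> hM; apply/rowP => l; rewrite !mxE; apply/hcomp_id/hM. Qed.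

Lemma lift_mx t r s (A : 'M[R]_(t, s)) (M : 'M_(r, s)) :
  (forall k, exists w, row k A = w *m M) -> exists X, A = X *m M.
Proof.
move=> /fin_all_exists[w hw]; exists (\matrix_k w k).
by apply/row_matrixP => k; rewrite row_mul rowK.
Qed.

Lemma lift_hmx t r s (degp : 'I_t -> nat) degr degs (A : 'M_(t, s)) (M : 'M_(r, s)) :
  hmx degp degs A -> hmx degr degs M ->
  (forall k, exists w, row k A = w *m M) ->
  exists X, hmx degp degr X /\ A = X *m M.
Proof.
move=> hA hM /fin_all_exists[w hw]; exists (\matrix_k hrow degr (degp k) (w k)).
split=> [k l m|]; first by rewrite !mxE => /hcomp_supp.
apply/row_matrixP => k; rewrite row_mul rowK -(hrowM _ _ hM) -hw.
by rewrite (hrow_id k hA).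
Qed.

Lemma hmxM t r s degp degr degs (A : 'M_(t, r)) (B : 'M_(r, s)) :
  hmx degp degr A -> hmx degr degs B -> hmx degp degs (A *m B).
Proof.
move=> hA hB k l m; rewrite mxE => /msupp_sum_le /flatten_mapP[j _].
move=> /msuppM_le /allpairsP[[m1 m2] /= [/hA h1 /hB h2 ->]].
by rewrite mdegD -addnA h2 h1.
Qed.

Lemma irrelevantM p q : irrelevant q -> irrelevant (p * q).
Proof. by case: (irrelevant_ideal K n) => _ _; apply. Qed.

Lemma irrelevant_mulmx t r s (A : 'M[R]_(t, r)) (B : 'M_(r, s)) :
  (forall k l, irrelevant (B k l)) -> forall k l, irrelevant ((A *m B) k l).
Proof.
move=> hB k l; rewrite mxE; apply: ideal_sum => [|j _]; first exact: irrelevant_ideal.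
exact: irrelevantM.
Qed.

Lemma mgr_min_free_res I (F : min_graded_resolution I) :
  min_free_res (mgr_map F) (mgr_aug F) I.
Proof. by case: F. Qed.

Section Unique.
Variables (I : R -> Prop) (F G : min_graded_resolution I).
Hypothesis hI : homog_ideal I.

Definition bdry (H : min_graded_resolution I) i (v : 'rV_(mgr_rank H i)) : Prop :=
  exists w, v = w *m mgr_map H i.

(* Chain maps f and g, with f g homotopic to the identity; [e] is the part of
   the homotopy coming from degree i - 1. *)
Lemma mgr_compare i : exists (f : 'M_(mgr_rank F i, mgr_rank G i))
    (g : 'M_(mgr_rank G i, mgr_rank F i)) (e : 'M_(mgr_rank F i)),
  [/\ hmx (@mgr_deg _ _ _ F i) (@mgr_deg _ _ _ G i) f,
      forall v, bdry v -> bdry (v *m f),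
      forall v, bdry v -> bdry (v *m g),
      (forall k l, irrelevant (e k l)) /\ (forall v, bdry v -> v *m e = 0) &
      forall v, bdry (v *m (f *m g - 1%:M - e))].
Proof.
have [hid hh] := hI; have [I0 hD hM] := hid.
elim: i => [|i [f [g [e [hf bf bg [e0 be] bfg]]]]].
  have aug_hmx (H : min_graded_resolution I) :
      hmx (@mgr_deg _ _ _ H 0) (fun=> 0%N) (mgr_aug H).
    move=> k l m; by rewrite ord1 addn0 => /(dhomog_mf (mgr_aug_homog k)).
  have augI (H H' : min_graded_resolution I) : exists X : 'M_(mgr_rank H 0, mgr_rank H' 0),
      hmx (@mgr_deg _ _ _ H 0) (@mgr_deg _ _ _ H' 0) X /\
      forall k, I ((mgr_aug H - X *m mgr_aug H') k 0).
    have /fin_all_exists[v hv] := fun k => mgr_aug_surj H' (mgr_aug H k 0).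
    exists (\matrix_k hrow (@mgr_deg _ _ _ H' 0) (mgr_deg k) (v k)); split=> [k l m|k].
      by rewrite !mxE => /hcomp_supp.
    have := hh (mgr_deg k) _ (hv k); congr I; rewrite raddfB /= !mxE; congr (_ - _).
      by rewrite pihomog_dE // mgr_aug_homog.
    transitivity ((hrow (fun=> 0%N) (mgr_deg k) (v k *m mgr_aug H')) 0 0).
      by rewrite !mxE /hcomp subn0.
    rewrite (hrowM _ _ (aug_hmx H')) mxE; apply: eq_bigr => j _.
    by rewrite !mxE.
  have augB (H H' : min_graded_resolution I) (X : 'M_(mgr_rank H 0, mgr_rank H' 0)) (v : 'rV_(mgr_rank H 0)) :
      (forall k, I ((mgr_aug H - X *m mgr_aug H') k 0)) ->
      I ((v *m mgr_aug H) 0 0 - (v *m X *m mgr_aug H') 0 0).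
    move=> hX; suff : I ((v *m (mgr_aug H - X *m mgr_aug H')) 0 0).
      by rewrite mulmxBr mulmxA sub_mxE.
    by rewrite mxE; apply: ideal_sum => // k _; apply: hM.
  have augZ (H H' : min_graded_resolution I) (X : 'M_(mgr_rank H 0, mgr_rank H' 0)) (v : 'rV_(mgr_rank H 0)) :
      (forall k, I ((mgr_aug H - X *m mgr_aug H') k 0)) ->
      I ((v *m mgr_aug H) 0 0) -> I ((v *m X *m mgr_aug H') 0 0).
    by move=> hX h'; have h := augB _ _ _ v hX; have := idealB hid h' h; rewrite opprB addrC subrK.
  have aug_bd H (v : 'rV_(mgr_rank H 0)) : I ((v *m mgr_aug H) 0 0) <-> bdry v.
    exact: mgr_aug_exact.
  have [f [hf If]] := augI F G; have [g [_ Ig]] := augI G F.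
  exists f, g, 0; split=> //.
  - by move=> v /aug_bd h; apply/aug_bd/augZ.
  - by move=> v /aug_bd h; apply/aug_bd/augZ.
  - by split=> [k l|v _]; rewrite ?mulmx0 // mxE /irrelevant mcoeff0.
  - move=> v; apply/aug_bd.
    rewrite subr0 mulmxBr mulmx1 mulmxBl mulmxA sub_mxE.
    have := idealN hid (hD _ _ (augB _ _ _ v If) (augB _ _ _ (v *m f) Ig)).
    by congr I; ring.
have bd H (v : 'rV_(mgr_rank H i.+1)) : v *m mgr_map H i = 0 <-> bdry v.
  exact: mgr_map_exact.
have dbd (H : min_graded_resolution I) k : bdry (row k (mgr_map H i)).
  by exists (delta_mx 0 k); rewrite rowE.
have [f' [hf' ef']] : exists f', hmx (@mgr_deg _ _ _ F i.+1) (@mgr_deg _ _ _ G i.+1) f' /\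
    mgr_map F i *m f = f' *m mgr_map G i.
  apply: lift_hmx (hmxM _ hf) _ _; [exact: mgr_map_homog | exact: mgr_map_homog |].
  by move=> k; rewrite row_mul; apply: bf; apply: dbd.
have [g' eg'] : exists g', mgr_map G i *m g = g' *m mgr_map F i.
  by apply: lift_mx => k; rewrite row_mul; apply: bg; apply: dbd.
have [h eh] : exists h, f *m g - 1%:M - e = h *m mgr_map F i.
  by apply: lift_mx => k; rewrite rowE; apply: bfg.
have de : mgr_map F i *m e = 0.
  by apply/row_matrixP => k; rewrite row_mul row0; apply: be; apply: dbd.
exists f', g', (mgr_map F i *m h); split=> //.
- by move=> v /bd v0; apply/bd; rewrite -mulmxA -ef' mulmxA v0 mul0mx.
- by move=> v /bd v0; apply/bd; rewrite -mulmxA -eg' mulmxA v0 mul0mx.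
- split; last by move=> v /bd v0; rewrite mulmxA v0 mul0mx.
  move=> k l; rewrite mxE; apply: ideal_sum => [|j _]; first exact: irrelevant_ideal.
  by rewrite mulrC; apply/irrelevantM/mgr_minimal.
- move=> v; apply/bd; rewrite -mulmxA; suff -> : (f' *m g' - 1%:M - mgr_map F i *m h) *m mgr_map F i = 0.
    by rewrite mulmx0.
  rewrite !mulmxBl mul1mx -[f' *m g' *m _]mulmxA -eg' mulmxA -ef' -!mulmxA -eh.
  by rewrite !mulmxBr mulmx1 de subr0 subrr.
Qed.

Lemma mgr_deg_exists i (k : 'I_(mgr_rank F i)) :
  exists l : 'I_(mgr_rank G i), mgr_deg l = mgr_deg k.
Proof.
have [f [g [e [hf _ _ [e0 _] bfg]]]] := mgr_compare i.
have [h eh] : exists h, f *m g - 1%:M - e = h *m mgr_map F i.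
  by apply: lift_mx => k'; rewrite rowE; apply: bfg.
have [l /eqP e1|nl] := pickP (fun l => @mgr_deg _ _ _ G i l == mgr_deg k).
  by exists l.
have hI0 := irrelevant_ideal K n.
have fg0 : irrelevant ((f *m g) k k).
  rewrite mxE; apply: ideal_sum => // l _; rewrite mulrC; apply: irrelevantM.
  apply/eqP; rewrite mcoeff_eq0; apply/negP => /hf; rewrite mdeg0 add0n => e1.
  by have := nl l; rewrite e1 eqxx.
have : irrelevant (1 : R).
  have -> : (1 : R) = (f *m g) k k - e k k - (h *m mgr_map F i) k k.
    by rewrite -eh !sub_mxE [1%:M k k]mxE eqxx mulr1n; ring.
  apply: idealB => //; first exact: idealB.
  by apply: irrelevant_mulmx; apply: mgr_minimal.
by rewrite /irrelevant mcoeff1 eqxx => /eqP; rewrite oner_eq0.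
Qed.

End Unique.

End Graded.

(** * Existence of minimal graded resolutions *)

Lemma exists_min (P : nat -> Prop) : (exists k, P k) ->
  exists k, P k /\ forall j, P j -> k <= j.
Proof.
pose p k : bool := if excluded_middle_informative (P k) then true else false.
have PP k : reflect (P k) (p k).
  by rewrite /p; case: excluded_middle_informative => h; constructor.
case=> k0 /PP hk0; have ex : exists k, p k by exists k0.
case: (ex_minnP ex) => k /PP hk h.
by exists k; split=> // j /PP; apply: h.
Qed.

Section Noetherian.
Import Order.TTheory GRing.Theory.
Local Open Scope ring_scope.
Variables (K : fieldType) (n : nat).
Local Notation R := {mpoly K[n]}.

Lemma dickson (L : seq 'I_n) (P : 'X_{1..n} -> Prop) :
  exists B : seq 'X_{1..n}, (forall b, b \in B -> P b) /\
    forall m, P m -> exists2 b, b \in B & forall i, i \in L -> (b i <= m i)%N.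
Proof.
elim: L P => [|a L IH] P.
  have [[m hm]|h] := excluded_middle_informative (exists m, P m).
    exists [:: m]; split=> [b|m' _]; first by rewrite inE => /eqP ->.
    by exists m; rewrite ?mem_head.
  by exists [::]; split=> // m hm; case: h; exists m.
have [B [hB dB]] := IH P.
pose N := (\max_(b <- B) b a)%N.
have /fin_all_exists[C hC] := fun k : 'I_N => IH (fun m => P m /\ m a = k).
exists (B ++ flatten [seq C k | k : 'I_N]); split=> [b|m hm].
  rewrite mem_cat => /orP[/hB //|/flatten_mapP[k _ bk]].
  by have [/(_ b bk)[]] := hC k.
have [Nm|mN] := leqP N (m a).
  have [b bB hb] := dB m hm; exists b; first by rewrite mem_cat bB.
  move=> i; rewrite inE => /orP[/eqP ->|/hb //].
  by apply: leq_trans Nm; apply: leq_bigmax_seq.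
have [_ /(_ m)[//|b bC hb]] := hC (Ordinal mN).
exists b.
  rewrite mem_cat; apply/orP; right; apply/flatten_mapP.
  by exists (Ordinal mN); rewrite ?mem_enum.
have [/(_ b bC)[_ /= e] _] := hC (Ordinal mN).
by move=> i; rewrite inE => /orP[/eqP ->|/hb //]; rewrite e.
Qed.

Definition submod r (N : 'rV[R]_r -> Prop) : Prop :=
  [/\ N 0, forall v w, N v -> N w -> N (v + w) & forall c v, N v -> N (c *: v)].

Definition fin_gen r (N : 'rV[R]_r -> Prop) : Prop :=
  exists gs : seq 'rV[R]_r, (forall g, g \in gs -> N g) /\
    forall S, submod S -> (forall g, g \in gs -> S g) -> forall v, N v -> S v.

Lemma pihomog0_const (p : R) : pihomog mdeg 0 p = (p@_0%MM)%:MP.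
Proof.
elim/mpolyind: p => [|c m p _ _ IH]; first by rewrite raddf0 mcoeff0 mpolyC0.
rewrite raddfD /= IH mcoeffD mpolyCD linearZ /= pihomogX mcoeffZ mcoeffX mdeg_eq0.
congr (_ + _); case: eqP => [->|_]; last by rewrite mulr0 scaler0 mpolyC0.
by rewrite mulr1 mpolyX0 alg_mpolyC.
Qed.

Lemma mleadB_lt (p q : R) : mlead p = mlead q -> p@_(mlead p) = q@_(mlead q) ->
  p - q != 0 -> (mlead (p - q) < mlead p)%O.
Proof.
move=> em ec pq; rewrite lt_neqAle; apply/andP; split.
  apply: contraNneq pq => e; by rewrite -mleadc_eq0 e mcoeffB ec em subrr.
by have := mleadB_le p q; rewrite -em joinxx.
Qed.

Lemma fin_gen_supported r k (N : 'rV[R]_r -> Prop) : submod N ->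
  (forall v, N v -> forall l : 'I_r, (k <= l)%N -> v 0 l = 0) -> fin_gen N.
Proof.
elim: k N => [|k IH] N hN hk.
  exists [::]; split=> // S [S0 _ _] _ v /hk h.
  by have -> : v = 0 by apply/rowP => l; rewrite h ?mxE.
have [rk|kr] := leqP r k.
  by apply: IH => // v _ l kl; have := leq_trans (ltn_ord l) (leq_trans rk kl); rewrite ltnn.
pose l0 := Ordinal kr; have [N0 ND NZ] := hN.
pose good m (v : 'rV[R]_r) := [/\ N v, v 0 l0 != 0 & mlead (v 0 l0) = m].
have [B [hB dB]] := dickson (enum 'I_n) (fun m => exists v, good m v).
pose W m := epsilon (inhabits 0) (good m).
have hW b : b \in B -> good b (W b) by move=> /hB; apply: epsilon_spec.
have [|v []//|gs [gsN hgs]] := IH (fun v => N v /\ v 0 l0 = 0).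
- split; first by rewrite mxE.
  + by move=> v w [Nv v0] [Nw w0]; split; [exact: ND|rewrite mxE v0 w0 addr0].
  + by move=> c v [Nv v0]; split; [exact: NZ|rewrite mxE v0 mulr0].
- move=> Nv v0 l; rewrite leq_eqVlt => /orP[/eqP e|/(hk _ Nv) //].
  by have -> : l = l0 by apply: val_inj.
exists (map W B ++ gs); split.
  move=> g; rewrite mem_cat => /orP[/mapP[b /hW[Nb _ _] -> //]|/gsN[]//].
move=> S hS Sg; have [S0 SD SZ] := hS.
have Sbase v : N v -> v 0 l0 = 0 -> S v.
  by move=> Nv v0; apply: (hgs S) => // g ggs; apply: Sg; rewrite mem_cat ggs orbT.
suff H (m : 'X_{1..n}) : forall v : 'rV[R]_r, mlead (v 0 l0) = m -> N v -> S v by move=> v; apply: (H _ v erefl).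
elim/(@ltmwf n): m => m wf v em Nv.
have [v0|v0] := eqVneq (v 0 l0) 0; first exact: Sbase.
have [|b bB hb] := dB m; first by exists v.
have [Nb b0 eb] := hW b bB; set w := W b in Nb b0 eb.
have bm : (b <= m)%MM by apply/mnm_lepP => i; apply: hb; rewrite mem_enum.
pose c := (v 0 l0)@_m / (w 0 l0)@_b.
have wb0 : (w 0 l0)@_b != 0 by rewrite -eb mleadc_eq0.
have vm0 : (v 0 l0)@_m != 0 by rewrite -em mleadc_eq0.
have c0 : c != 0 by rewrite mulf_neq0 ?invr_eq0.
pose u : R := c *: 'X_[m - b].
have Su : S (u *: w) by apply/SZ/Sg; rewrite mem_cat map_f.
have Nu : N (v - u *: w) by rewrite -scaleNr; apply/ND/NZ.
rewrite -(subrK (u *: w) v); apply: SD => //.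
have [e|ne] := eqVneq ((v - u *: w) 0 l0) 0; first exact: Sbase.
apply: wf _ _ _ erefl Nu.
rewrite !sub_scale_mxE in ne *; rewrite -em.
have u0 : u != 0 by rewrite -msupp_eq0 msuppMCX.
have eu : mlead (u * w 0 l0) = m.
  by rewrite mleadM // mleadZ // mleadXm eb submK.
apply: mleadB_lt => //; first by rewrite eu.
rewrite eu em; have := mleadcM u (w 0 l0).
rewrite mleadZ // mleadXm eb submK // => ->.
by rewrite mcoeffZ mcoeffX eqxx mulr1 divfK.
Qed.

Lemma fin_genP r (N : 'rV[R]_r -> Prop) : submod N -> fin_gen N.
Proof.
move=> hN; apply: (fin_gen_supported (k := r)) => // v _ l rl.
by have := leq_trans (ltn_ord l) rl; rewrite ltnn.
Qed.

Definition graded_submod r (deg : 'I_r -> nat) (N : 'rV[R]_r -> Prop) : Prop :=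
  submod N /\ forall e v, N v -> N (hrow deg e v).

Definition generates r (deg : 'I_r -> nat) (N : 'rV[R]_r -> Prop) t
    (x : ('I_t -> nat) * 'M[R]_(t, r)) : Prop :=
  hmx x.1 deg x.2 /\ forall v, N v <-> exists w, v = w *m x.2.

Lemma submodM r (N : 'rV[R]_r -> Prop) t (w : 'rV_t) (M : 'M[R]_(t, r)) :
  submod N -> (forall k, N (row k M)) -> N (w *m M).
Proof.
case=> N0 ND NZ h; rewrite mulmx_sum_row.
by elim/big_ind: _ => // k _; apply: NZ.
Qed.

Lemma generates_exists r (deg : 'I_r -> nat) N : graded_submod deg N ->
  exists t x, @generates r deg N t x.
Proof.
move=> [hN hh]; have [gs [gsN hgs]] := fin_genP hN.
pose b (g : 'rV[R]_r) := (\max_l (msize (g 0%R l) + deg l))%N.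
pose hs := [seq (hrow deg e g, e) | g <- gs, e <- iota 0 (b g)].
pose x0 : 'rV[R]_r * nat := (0, 0%N).
pose M := \matrix_(k < size hs) (nth x0 hs k).1.
have hsP (k : 'I_(size hs)) : exists g e, g \in gs /\ nth x0 hs k = (hrow deg e g, e).
  have /allpairsPdep[g [e [ggs _ ->]]] := mem_nth x0 (ltn_ord k).
  by exists g, e.
exists (size hs), (fun k : 'I_(size hs) => (nth x0 hs k).2, M); split=> [k l m|v] /=.
  by rewrite mxE; have [g [e [_ ->]]] := hsP k; rewrite mxE => /hcomp_supp.
split=> [|[w ->]]; last first.
  apply: submodM => // k; rewrite rowK; have [g [e [ggs ->]]] := hsP k.
  exact/hh/gsN.
move: v; apply: hgs => [|g ggs].
  split; first by exists 0; rewrite mul0mx.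
    by move=> v w [v' ->] [w' ->]; exists (v' + w'); rewrite mulmxDl.
  by move=> c v [v' ->]; exists (c *: v'); rewrite scalemxAl.
have hk e : (e < b g)%N -> exists w, hrow deg e g = w *m M.
  move=> eb; have : (hrow deg e g, e) \in hs.
    by apply/allpairsPdep; exists g, e; rewrite mem_iota.
  move=> /(nthP x0)[k ks ek]; exists (delta_mx 0 (Ordinal ks)).
  by rewrite -rowE rowK /= ek.
have /fin_all_exists[w hw] := fun e : 'I_(b g) => hk e (ltn_ord e).
exists (\sum_e w e); rewrite mulmx_suml; under eq_bigr do rewrite -hw.
apply/rowP => l; rewrite summxE; under eq_bigr do rewrite mxE.
by apply: hcomp_sum; apply: leq_bigmax.
Qed.

(* If a syzygy of a generating set of minimal size had a nonzero constant
   term, its homogeneous component would express a generator by the others. *)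
Lemma min_generates_exists r (deg : 'I_r -> nat) N : graded_submod deg N ->
  exists t x, @generates r deg N t x /\
    forall w : 'rV_t, w *m x.2 = 0 -> forall k, irrelevant (w 0 k).
Proof.
move=> /generates_exists/exists_min[t [[[dg M] [hM gM]] tmin]].
exists t, (dg, M); split=> // w /= wM k; apply/eqP/negPn/negP => wk0.
pose w' := hrow dg (dg k) w.
have w'M : w' *m M = 0.
  rewrite -(hrowM _ _ hM) wM; apply/rowP => l.
  by rewrite !mxE hcomp0.
pose c := (w 0 k)@_0%MM.
have w'k : w' 0 k = c%:MP.
  by rewrite mxE /hcomp leqnn subnn pihomog0_const.
case: t dg M hM gM tmin w wM k wk0 @w' w'M @c w'k => [|t] dg M hM gM tmin w wM k.
  by case: (k).
move=> wk0 w' w'M c w'k.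
suff : (t.+1 <= t)%N by rewrite ltnn.
apply: tmin; exists (fun j : 'I_t => dg (lift k j), row' k M); split=> /=.
  by move=> j l m; rewrite mxE => /hM.
have split_row (y : 'rV_t.+1) : y *m M = y 0 k *: row k M + col' k y *m row' k M.
  apply/rowP => l; rewrite !mxE (bigD1_ord k) //=; congr (_ + _).
  by apply: eq_bigr => j _; rewrite !mxE.
move=> v; rewrite gM; split=> -[y ->].
  pose z := y - (y 0 k * c^-1%:MP) *: w'.
  have -> : y *m M = z *m M by rewrite mulmxBl -scalemxAl w'M scaler0 subr0.
  exists (col' k z); rewrite split_row sub_scale_mxE w'k -mulrA -mpolyCM mulVf //.
  by rewrite mpolyC1 mulr1 subrr scale0r add0r.
exists (\row_j if unlift k j is Some i then y 0 i else 0).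
rewrite split_row mxE unlift_none scale0r add0r; congr (_ *m _).
by apply/rowP => j; rewrite !mxE liftK.
Qed.

Record stage := Stage {
  st_rank : nat;
  st_next_rank : nat;
  st_deg : 'I_st_rank -> nat;
  st_next_deg : 'I_st_next_rank -> nat;
  st_map : 'M[R]_(st_next_rank, st_rank)
}.

Definition good_stage (s : stage) : Prop :=
  [/\ hmx (@st_next_deg s) (@st_deg s) (st_map s),
      forall k l, irrelevant (st_map s k l) &
      forall w : 'rV_(st_next_rank s), w *m st_map s = 0 -> forall k, irrelevant (w 0 k)].

Definition min_generates r (deg : 'I_r -> nat) N
    (x : {t : nat & (('I_t -> nat) * 'M[R]_(t, r))%type}) : Prop :=
  generates deg N (projT2 x) /\
  forall w : 'rV_(projT1 x), w *m (projT2 x).2 = 0 -> forall k, irrelevant (w 0 k).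

Definition min_gens r (deg : 'I_r -> nat) N :
    {t : nat & (('I_t -> nat) * 'M[R]_(t, r))%type} :=
  epsilon (inhabits (existT _ 0%N (fun=> 0%N, 0))) (min_generates deg N).

Lemma min_gensP r (deg : 'I_r -> nat) N :
  graded_submod deg N -> min_generates deg N (min_gens deg N).
Proof.
move=> /min_generates_exists[t [y hy]].
by apply: epsilon_spec; exists (existT _ t y).
Qed.

Definition next_stage (s : stage) : stage :=
  let x := min_gens (@st_next_deg s) (fun v => v *m st_map s = 0) in
  Stage (@st_next_deg s) (projT2 x).1 (projT2 x).2.

Lemma next_stageP s : good_stage s -> good_stage (next_stage s) /\
  forall v : 'rV_(st_next_rank s),
    v *m st_map s = 0 <-> exists w, v = w *m st_map (next_stage s).
Proof.
move=> [hM _ zM].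
have hN : graded_submod (@st_next_deg s) (fun v => v *m st_map s = 0).
  split; first split.
  - by rewrite mul0mx.
  - by move=> v w hv hw; rewrite mulmxDl hv hw addr0.
  - by move=> c v hv; rewrite -scalemxAl hv scaler0.
  - by move=> e v hv; rewrite -(hrowM _ _ hM) hv; apply/rowP => l; rewrite !mxE hcomp0.
have [[h1 h2] h3] := min_gensP hN; split=> //; split=> // k l.
have : row k (st_map (next_stage s)) *m st_map s = 0.
  by apply/h2; exists (delta_mx 0 k); rewrite rowE.
by move/zM/(_ l); rewrite mxE.
Qed.

Lemma min_graded_resolution_exists (I : R -> Prop) : homog_ideal I -> ~ I 1 ->
  inhabited (min_graded_resolution I).
Proof.
move=> [hI hh] I1; have [I0 ID IM] := hI.
pose N (v : 'rV[R]_1) := I (v 0 0).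
have hN : graded_submod (fun _ : 'I_1 => 0%N) N.
  split; first split; rewrite /N; first by rewrite mxE.
  - by move=> v w hv hw; rewrite mxE; apply: ID.
  - by move=> c v hv; rewrite mxE; apply: IM.
  - by move=> e v hv; rewrite mxE /hcomp subn0; apply: hh.
have [[h1 h2] h3] := min_gensP hN; set x := min_gens _ _ in h1 h2 h3.
pose st i := iter i next_stage (Stage (fun=> 0%N) (projT2 x).1 (projT2 x).2).
have Iirr f : I f -> irrelevant f.
  move=> /(hh 0%N) h; apply/eqP/negPn/negP => f0; apply: I1.
  have := IM (f@_0%MM)^-1%:MP _ h; congr I.
  by rewrite pihomog0_const -mpolyCM mulVf // mpolyC1.
have hst i : good_stage (st i).
  elim: i => [|i /next_stageP[]//]; split=> //= k l.
  rewrite ord1; apply: Iirr; have : N (row k (projT2 x).2).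
    by apply/h2; exists (delta_mx 0 k); rewrite rowE.
  by rewrite /N mxE.
have aug1 (v : 'rV[R]_1) : (v *m (const_mx 1 : 'cV_1)) 0 0 = v 0 0.
  by rewrite mxE big_ord1 mxE mulr1.
constructor; apply: (@MinGradedResolution K n I (fun i => st_rank (st i))
  (fun i => @st_deg (st i)) (fun i => st_map (st i)) (const_mx 1)).
- by move=> k; rewrite mxE dhomog1.
- by move=> i; have [] := hst i.
- by move=> f; exists (const_mx f); rewrite aug1 mxE subrr.
- by move=> v; rewrite aug1; apply: h2.
- by move=> i; have [_] := next_stageP (hst i).
- by move=> i; have [_ h _] := hst i.
Qed.

End Noetherian.

(** * Shellable complexes and expansions *)

Lemma nat_maxE (P : nat -> Prop) m :
  P m -> (forall k, P k -> k <= m) -> nat_max P = m.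
Proof.
move=> Pm le; have h : exists m, P m /\ forall k, P k -> k <= m by exists m.
have [Pe he] := epsilon_spec (inhabits 0) _ h.
by apply/eqP; rewrite eqn_leq /nat_max le ?he.
Qed.

Section Invariants.
Import GRing.Theory.
Local Open Scope ring_scope.
Variables (K : fieldType) (n : nat).

Lemma betti_neq0 (I : {mpoly K[n]} -> Prop) (F : min_graded_resolution I) i j :
  homog_ideal I ->
  betti I i j <> 0%N <-> exists k : 'I_(mgr_rank F i), mgr_deg k = j.
Proof.
move=> hI; set B := fun b => exists F : min_graded_resolution I,
  b = #|[set k : 'I_(mgr_rank F i) | mgr_deg k == j]|.
have ex : exists b, B b by eexists; exists F.
have [G eG] := epsilon_spec (inhabits 0%N) _ ex.
rewrite /betti -/B eG; split=> [/eqP|[k hk]].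
  rewrite -lt0n => /card_gt0P[k]; rewrite inE => /eqP <-.
  exact: mgr_deg_exists.
apply/eqP; rewrite -lt0n; apply/card_gt0P.
by have [l hl] := mgr_deg_exists G hI k; exists l; rewrite inE hl hk.
Qed.

Lemma pdE (I : {mpoly K[n]} -> Prop) (F : min_graded_resolution I) p :
  homog_ideal I -> mgr_rank F p <> 0%N ->
  (forall i, mgr_rank F i <> 0%N -> (i <= p)%N) -> pd I = p.
Proof.
move=> hI hp le; apply: nat_maxE => [|i [j /(betti_neq0 F _ _ hI)[k _]]].
  have k : 'I_(mgr_rank F p) by case: (mgr_rank F p) hp => // r _; exact: ord0.
  by exists (mgr_deg k); apply/(betti_neq0 F) => //; exists k.
by apply: le => e; case: k => m; rewrite e.
Qed.

Theorem shellable_pd_depth (D : {set {set 'I_n}}) (F : {set 'I_n}) :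
  set0 \in D -> down_closed (mem D) -> shellable D -> F \in facets D ->
  (forall G, G \in facets D -> (#|F| <= #|G|)%N) ->
  pd (stanley_reisner (K := K) D) = (n - #|F|)%N /\
  depth (stanley_reisner (K := K) D) = #|F|.
Proof.
move=> D0 dD [s [_ sD sh]] FD Fmin; rewrite stanley_reisnerE //.
set I := mono_ideal _; have hI : homog_ideal I := mono_idealP K dD.
have [hid _] := hI.
have wr : weakly_regular I (mesyms K n #|F|).
  have -> : I = mono_ideal (subface s); last first.
    by apply: shelling_regular => // G; rewrite sD; apply: Fmin.
  congr mono_ideal; apply: functional_extensionality => A.
  apply/idP/hasP => [AD|[G + AG]]; last first.
    by rewrite sD inE => /maxsetP[GD _]; apply: dD GD.
  have [G mG AG] := @maxset_exists _ (fun A => A \in D) A AD.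
  by exists G => //; rewrite sD inE.
have irI f : I f -> irrelevant f.
  move=> h; apply/eqP; rewrite mcoeff_eq0; apply/negP => /h.
  suff -> : msupport 0%MM = set0 :> {set 'I_n} by rewrite [_ set0]D0.
  by apply/setP => i; rewrite !inE mnm0E.
have ir1 : ~ irrelevant (1 : {mpoly K[n]}).
  by rewrite /irrelevant mcoeff1 eqxx => /eqP; rewrite oner_eq0.
have [H] := min_graded_resolution_exists hI (fun h => ir1 (irI _ h)).
have rH : mgr_rank H (n - #|F|) <> 0%N.
  move: FD; rewrite inE => /maxsetP[FD mF].
  have -> : (n - #|F| = #|~: F|)%N.
    by have := cardsC F; rewrite card_ord => e; rewrite -[X in (X - _)%N]e addKn.
  apply: (res_rank_facet (mgr_min_free_res H) (u := xset K F)) => //.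
    move=> /(_ (mesym1 F)); rewrite msuppX mem_head msupport_mesym1.
    by move/(_ isT); rewrite [_ F]FD.
  move=> j jF; rewrite mulrC -xset1; apply/mono_idealMxset.
  move=> m; rewrite msuppX inE => /eqP ->; rewrite msupport_mesym1.
  apply/negP => h; have := mF _ h (subsetUr _ _) => e.
  by move: jF; rewrite -e setU11.
have Fn : (#|F| <= n)%N by rewrite -[X in (_ <= X)%N]card_ord max_card.
have mes0 f : f \in mesyms K n #|F| -> irrelevant f.
  move=> /mapP[k _ ->]; apply: (dhomog_nemf_coeff (dhomog_mesym _ _ _)).
  by rewrite /= mdeg0.
split.
  apply: (pdE (F := H)) => // i ri; rewrite leq_subRL // addnC.
  have := res_length_regular hid (mgr_min_free_res H) mes0 wr ri.
  by rewrite size_mkseq.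
apply: nat_maxE => [|d [fs [<- fs0 /regular_seqE[wfs _]]]].
  exists (mesyms K n #|F|); split=> //; first by rewrite size_mkseq.
  apply/regular_seqE; split=> // -[c /irI].
  set S := \sum_(i < _) _ => h; apply: ir1.
  have hir := irrelevant_ideal K n.
  rewrite -(subrK S 1); case: (hir) => _ hD _; apply: hD => //.
  apply: ideal_sum => // i _; apply: irrelevantM; apply: mes0.
  exact: mem_nth.
have := res_length_regular hid (mgr_min_free_res H) fs0 wfs rH.
by rewrite -leq_subRL ?leq_subr // subKn.
Qed.

End Invariants.

Section Expansion.
Variables (n : nat) (s : 'I_n -> nat) (D : {set {set 'I_n}}).
Local Notation N := (\sum_(i < n) s i).
Local Notation choice := {dffun forall i : 'I_n, 'I_(s i)}.
Implicit Types (F G : {set 'I_n}) (p q r : choice) (A E : {set 'I_N}).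

Lemma Rank_fun_inj r : injective (fun i => tagnat.Rank i (r i)).
Proof. by move=> i j /(congr1 (@tagnat.sig1 _ _)); rewrite !tagnat.Rank1K. Qed.

Lemma card_expansion_facet F r : #|expansion_facet F r| = #|F|.
Proof. by rewrite card_imset //; apply: Rank_fun_inj. Qed.

Lemma expansion_down_closed : down_closed (mem (expansion s D)).
Proof.
move=> A B AB; rewrite /= !inE => /existsP[F /andP[FD /existsP[r BF]]].
apply/existsP; exists F; rewrite FD; apply/existsP; exists r.
exact: subset_trans BF.
Qed.

Lemma expansion_facetD F G r :
  expansion_facet F r :\: expansion_facet G r = expansion_facet (F :\: G) r.
Proof.
apply/setP => x; rewrite -[x]tagnat.sig2K inE !mem_expansion_facet inE.
by case: (_ \in F); case: (_ \in G); case: (_ == _).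
Qed.

Definition expansion_base A : {set 'I_n} := [set tagnat.sig1 x | x in A].

Lemma expansion_baseE F r : expansion_base (expansion_facet F r) = F.
Proof.
rewrite /expansion_base /expansion_facet -imset_comp -[RHS]imset_id.
by apply: eq_imset => i; rewrite /= tagnat.Rank1K.
Qed.

Definition weight A := \sum_(x in A) val x.

Lemma weightE F r : weight (expansion_facet F r) = \sum_(i in F) val (tagnat.Rank i (r i)).
Proof. by rewrite /weight big_imset //= => i j _ _; apply: Rank_fun_inj. Qed.

Lemma leq_Rank i (k l : 'I_(s i)) : (tagnat.Rank i k <= tagnat.Rank i l) = (k <= l).
Proof. by rewrite !tagnat.RankEsum leq_add2l. Qed.

Lemma weight_lt F p q i : i \in F -> p i < q i ->
  (forall j, j \in F -> p j <= q j) ->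
  weight (expansion_facet F p) < weight (expansion_facet F q).
Proof.
move=> iF pq le; rewrite !weightE !(bigD1 i iF) /= -addSn leq_add //.
  by rewrite ltnNge leq_Rank -ltnNge.
by apply: leq_sum => j /andP[jF _]; rewrite leq_Rank le.
Qed.

(* Facets are ordered first by the position of their base in the given
   shelling, then by the sum of the chosen indices. *)
Lemma shellable_expansion : shellable D -> shellable (expansion s D).
Proof.
case=> L [uL LD shL].
pose big := (\sum_(x < N) val x).+1.
have wbig A : weight A < big.
  by rewrite ltnS /weight [X in _ <= X](bigID (mem A)) /= leq_addr.
pose rho A := index (expansion_base A) L * big + weight A.
have rho_lt A E : index (expansion_base A) L < index (expansion_base E) L -> rho A < rho E.
  move=> h; apply: (@leq_trans ((index (expansion_base A) L).+1 * big)).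
    by rewrite /rho mulSn -addnS addnC leq_add2r.
  by apply: leq_trans (leq_addr _ _); rewrite leq_mul2r h orbT.
have key E A : E \in facets (expansion s D) -> A \in facets (expansion s D) ->
    E != A -> rho E <= rho A ->
    exists v, v \in A :\: E /\ exists H, [/\ H \in facets (expansion s D),
      rho H < rho A & A :\: H = [set v]].
  move=> /mem_facets_expansion[F [p [FD ->]]] /mem_facets_expansion[G [q [GD ->]]].
  have facetE F' r : F' \in facets D -> expansion_facet F' r \in facets (expansion s D).
    by move=> h; apply/mem_facets_expansion; exists F', r.
  move=> ne le; have {le} : index F L <= index G L /\ (index F L = index G L ->
      weight (expansion_facet F p) <= weight (expansion_facet G q)).
    split.
      rewrite leqNgt; apply: contraL le => h; rewrite -ltnNge; apply: rho_lt.
      by rewrite !expansion_baseE.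
    by move=> e; move: le; rewrite /rho !expansion_baseE e leq_add2l.
  case; rewrite leq_eqVlt => /orP[/eqP e /(_ e)|h _].
    have {e FD} e : F = G by rewrite -(nth_index set0 (_ : F \in L)) ?LD // e nth_index ?LD.
    rewrite e in ne * => le {F e}.
    have [i /andP[iG pq]|npq] := pickP (fun i => (i \in G) && (p i < q i)); last first.
      have qp j : j \in G -> q j <= p j.
        by move=> jG; have := npq j; rewrite jG /= ltnNge => /negbFE.
      have [i /andP[iG pqi]|epq] := pickP (fun i => (i \in G) && (p i != q i)).
        have : q i < p i by rewrite ltn_neqAle qp // andbT eq_sym.
        by move=> /(weight_lt iG)/(_ qp); rewrite ltnNge le.
      case/eqP: ne; apply: eq_in_imset => i iG; have := epq i.
      by rewrite iG => /negbFE/eqP ->.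
    pose q' : choice := [ffun j => if j == i then p j else q j].
    exists (tagnat.Rank i (q i)); split.
      rewrite inE !mem_expansion_facet iG eqxx /= andbT.
      by apply: contraTneq pq => ->; rewrite ltnn.
    exists (expansion_facet G q'); split; first exact: facetE.
      rewrite /rho !expansion_baseE ltn_add2l; apply: (weight_lt iG).
        by rewrite ffunE eqxx.
      by move=> j _; rewrite ffunE; case: eqP => [->|_] //; apply: ltnW.
    apply/setP => x; rewrite -[x]tagnat.sig2K !inE !mem_expansion_facet ffunE.
    move: (tagnat.sig1 x) (tagnat.sig2 x) => j k.
    rewrite -[RHS]val_eqE /= tagnat.eq_Rank.
    case: (eqVneq j i) k => [-> k|ji k]; last by case: (_ \in G); case: (_ == _).
    rewrite iG /= val_eqE; case: (eqVneq k (q i)) => [->|]; last by rewrite andbF.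
    by rewrite andbT; apply: contraTneq pq => ->; rewrite ltnn.
  have GL : index G L < size L by rewrite index_mem LD.
  have [v [+ [l [lG]]]] := shL _ _ h GL.
  rewrite !nth_index ?LD // => vGF el.
  have lL : l < size L := ltn_trans lG GL.
  exists (tagnat.Rank v (q v)); split.
    move: vGF; rewrite !inE !mem_expansion_facet => /andP[/negbTE -> ->].
    by rewrite eqxx.
  exists (expansion_facet (nth set0 L l) q); split.
  - by apply: facetE; rewrite -LD mem_nth.
  - by apply: rho_lt; rewrite !expansion_baseE index_uniq.
  - by rewrite expansion_facetD el /expansion_facet imset_set1.
pose t := sort (relpre rho leq) (enum (facets (expansion s D))).
have tE : t =i facets (expansion s D) by move=> A; rewrite mem_sort mem_enum.
have ut : uniq t by rewrite sort_uniq enum_uniq.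
have mono_t i j : j < size t -> i <= j -> rho (nth set0 t i) <= rho (nth set0 t j).
  move=> jt ij; apply: (@sorted_leq_nth _ (relpre rho leq)) => //.
  - by move=> x y z; apply: leq_trans.
  - by move=> x; apply: leqnn.
  - by apply: sort_sorted => x y; apply: leq_total.
  - exact: leq_ltn_trans ij jt.
exists t; split=> // i j ij jt; have it := ltn_trans ij jt.
have [||||v [hv [H [Hf Hlt Hv]]]] := key (nth set0 t i) (nth set0 t j).
- by rewrite -tE mem_nth.
- by rewrite -tE mem_nth.
- by rewrite nth_uniq // neq_ltn ij.
- exact/mono_t/ltnW.
exists v; split=> //; exists (index H t).
have Ht : H \in t by rewrite tE.
rewrite nth_index //; split=> //; rewrite ltnNge; apply/negP => jH.
by have := mono_t _ _ _ jH; rewrite index_mem nth_index // leqNgt Hlt => /(_ Ht).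
Qed.

End Expansion.

Theorem theorem3p1 (K : fieldType) (n : nat) (D : {set {set 'I_n}})
    (s : 'I_n -> nat)
    (hD : simplicial_complex D) (hsh : shellable D)
    (hs : forall i : 'I_n, 0 < s i) :
  pd (stanley_reisner (K := K) (expansion s D))
    = pd (stanley_reisner (K := K) D) + \sum_(i < n) s i - n
  /\ depth (stanley_reisner (K := K) (expansion s D))
    = depth (stanley_reisner (K := K) D).
Proof.
have [D0 _ hdown] := hD.
have dD : down_closed (mem D) by move=> A B AB BD; apply: hdown AB.
have [F0 mF0 _] := @maxset_exists _ (fun A => A \in D) set0 D0.
have F0D : F0 \in facets D by rewrite inE.
pose F := [arg min_(F < F0 in facets D) #|F|].
have [FD Fmin] : F \in facets D /\ forall G, G \in facets D -> #|F| <= #|G|.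
  by rewrite /F; case: arg_minnP.
pose r : {dffun forall i : 'I_n, 'I_(s i)} := [ffun i => Ordinal (hs i)].
have E0 : set0 \in expansion s D.
  rewrite inE; apply/existsP; exists F; rewrite FD; apply/existsP; exists r.
  exact: sub0set.
have [-> ->] := shellable_pd_depth K D0 dD hsh FD Fmin.
have [||-> ->] := shellable_pd_depth K E0 (expansion_down_closed (D := D))
  (shellable_expansion s hsh) (F := expansion_facet F r).
- by apply/mem_facets_expansion; exists F, r.
- move=> _ /mem_facets_expansion[G [q [GD ->]]].
  by rewrite !card_expansion_facet Fmin.
rewrite card_expansion_facet; split=> //.
have Fn : #|F| <= n by rewrite -[X in _ <= X]card_ord max_card.
by rewrite addnC addnBA // subnAC addnK.
Qed.
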